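(* Let $\alpha\ge1$ and let $(\varphi,\psi)$ be a pair of kernels with $M_0(\psi)<+\infty$. For every $f\in L^{\eta_\alpha}(\mathbb{R})$ there exists $\lambda>0$ such that $$\lim_{w\to+\infty}\int_{\mathbb{R}}\left(\exp\left[\left(\lambda\left|S_w^{\varphi,\psi}f(x)-f(x)\right|\right)^\alpha\right]-1\right)dx=0.$$
   Context: For $g:\mathbb{R}\to\mathbb{R}$ and $\nu\ge 0$ put $$M_\nu(g):=\sup_{u\in\mathbb{R}}\sum_{k\in\mathbb{Z}}|g(u-k)|\,|u-k|^\nu,$$ so that $M_0(g)=\sup_{u}\sum_{k}|g(u-k)|$. A pair of kernels $(\varphi,\psi)$ is a pair of functions $\varphi,\psi:\mathbb{R}\to\mathbb{R}$ in $L^1(\mathbb{R})$ such that: $\varphi$ is bounded in a neighborhood of the origin; $\sum_{k\in\mathbb{Z}}\varphi(u-k)=1$ for every $u\in\mathbb{R}$; $\int_{\mathbb{R}}\psi(u)\,du=1$; and there exists $r>0$ with $M_r(\varphi)<+\infty$. The Durrmeyer sampling operators are, for $w>0$ and any $f$ for which the series converges for every $x$, $$(S_w^{\varphi,\psi}f)(x)=\sum_{k\in\mathbb{Z}}\varphi(wx-k)\,w\int_{\mathbb{R}}\psi(wu-k)f(u)\,du,\qquad x\in\mathbb{R}.$$ Let $\eta_\alpha(u)=e^{u^\alpha}-1$ for $u\ge0$. The exponential space $L^{\eta_\alpha}(\mathbb{R})$ is the set of Lebesgue measurable $f:\mathbb{R}\to\mathbb{R}$ such that $\int_{\mathbb{R}}\left(\exp[(\lambda|f(x)|)^\alpha]-1\right)dx<+\infty$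 for some $\lambda>0$. *)

(* Defs.v *)
From mathcomp Require Import all_boot all_order all_algebra.
From mathcomp Require Import all_classical all_reals all_analysis.
Import Order.TTheory GRing.Theory Num.Theory.
Import numFieldNormedType.Exports.

Set Implicit Arguments.
Unset Strict Implicit.
Unset Printing Implicit Defensive.

Local Open Scope classical_set_scope.
Local Open Scope ring_scope.

(* The real line with the sigma-algebra of Lebesgue measurable sets, the domain
   of completed_lebesgue_measure. The library's lebesgue_measure lives on the
   Borel sigma-algebra only. *)
Notation lebesgueTypeR R := (caratheodory_type ((wlength (R := R) idfun)^*)%mu).

Section two_sided_series.
Context {R : realType}.
Implicit Type a : int -> R.

(* A series over Z converges when its two halves k >= 0 and k < 0 do;
   Negz n is the integer - n.+1. *)
Definition zseries_cvg a : Prop :=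
  cvgn (series (fun n : nat => a (Posz n))) /\
  cvgn (series (fun n : nat => a (Negz n))).

(* Meaningful only under zseries_cvg a. *)
Definition zsum a : R :=
  limn (series (fun n : nat => a (Posz n))) +
  limn (series (fun n : nat => a (Negz n))).

End two_sided_series.

Section durrmeyer.
Context {R : realType}.
Implicit Types (g f phi psi : R -> R).

Local Notation mu := (@completed_lebesgue_measure R).

(* Since 0 `^ 0 = 1, the weight is 1 everywhere when nu = 0. *)
Definition abs_moment (nu : R) g : \bar R :=
  ereal_sup (range (fun u : R =>
    \esum_(k in [set: int]) (`|g (u - k%:~R)| * `|u - k%:~R| `^ nu)%:E)).

Definition lebesgue_L1 g : Prop :=
  mu.-integrable [set: lebesgueTypeR R] (EFin \o g).

Record kernel_pair phi psi : Prop := {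
  kernel_phi_L1 : lebesgue_L1 phi ;
  kernel_psi_L1 : lebesgue_L1 psi ;
  kernel_phi_bounded : bounded_near phi (nbhs (0 : R)) ;
  kernel_phi_sum : forall u : R,
    zseries_cvg (fun k => phi (u - k%:~R)) /\
    zsum (fun k => phi (u - k%:~R)) = 1 ;
  kernel_psi_int : \int[mu]_u psi u = 1 ;
  kernel_phi_moment : exists2 r : R, 0 < r & (abs_moment r phi < +oo)%E
}.

Definition durrmeyer_term phi psi (w : R) f (x : R) (k : int) : R :=
  phi (w * x - k%:~R) * (w * \int[mu]_u (psi (w * u - k%:~R) * f u)).

Definition durrmeyer_defined phi psi (w : R) f : Prop :=
  (forall k : int, lebesgue_L1 (fun u => psi (w * u - k%:~R) * f u)) /\
  (forall x : R, zseries_cvg (durrmeyer_term phi psi w f x)).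

(* Meaningful only under durrmeyer_defined phi psi w f. *)
Definition durrmeyer phi psi (w : R) f (x : R) : R :=
  zsum (durrmeyer_term phi psi w f x).

Definition exp_space (alpha : R) : set (R -> R) :=
  [set f : R -> R | measurable_fun [set: lebesgueTypeR R] f /\
    exists2 lambda : R, 0 < lambda &
      (\int[mu]_x (expR ((lambda * `|f x|) `^ alpha) - 1)%:E < +oo)%E].

End durrmeyer.

(* Main.v *)
Require Import Defs.
From mathcomp Require Import all_boot all_order all_algebra.
From mathcomp Require Import all_classical all_reals all_analysis.
From mathcomp Require Import measurable_realfun simple_functions.
From mathcomp Require Import ring lra zify.
Import Order.TTheory GRing.Theory Num.Theory.
Import numFieldNormedType.Exports.

(** Write eta t = exp (t ^ alpha) - 1, a convex increasing function of t >= 0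
    that vanishes at 0, let A bound the sums of |phi (u - k)| over k, let B
    bound those of |psi (u - k)|, and let b be the L1 norm of psi.  A is finite
    because |phi (u - k)| is controlled by the moment of order r when u - k is
    far from 0, and by the local bound of phi for the few remaining k.

    Since the translates of phi sum to 1 and psi has integral 1,
    S_w f (x) - f x is the sum over k of the integrals over u of
      phi (w x - k) w psi (w u - k) (f u - f x),
    and the absolute values of these weights have total mass at most A b.
    Jensen's inequality for eta therefore gives
      A b eta (lambda |S_w f (x) - f x|)
        <= sum_k int |phi (w x - k)| w |psi (w u - k)|
             eta (lambda A b |f u - f x|) du.
    The point of the proof is to get rid of eta at this stage.  As eta is
    superadditive, eta |s - t| <= |g s - g t| for the odd function g with
    g t = eta (2 t) on t >= 0 (eta_dist_le).  So with
    G = g (lambda A b f) the modular is at most 1 / (A b) times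
      osc w G = sum_k int int |phi (w x - k)| w |psi (w u - k)| |G u - G x| du dx,
    and G is integrable as soon as 2 lambda A b is the parameter for which f
    belongs to the exponential space.  The modular convergence of S_w f is thus
    reduced to a statement about L1: osc w G tends to 0 for every integrable G
    (osc_vanishes_L1).

    That statement is a density argument.  The functional is sublinear in G
    and at most a constant times the L1 norm of G (osc_le_norm), so it is
    enough to treat indicators of intervals, because finite unions of
    intervals approximate a measurable set of finite measure.  For an interval,
    the substitution s = w x - k, t = w u - k turns the functional into the
    integral of |phi s| |psi t| against 1 / w times the number of k for which
    (s + k) / w and (t + k) / w are separated by an endpoint.  This weight is
    bounded and at most a constant times (|s| + |t| + 1) / w
    (scaled_count_le), and dominated convergence concludes
    (osc_vanishes_itv). *)

Local Open Scope classical_set_scope.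
Local Open Scope ring_scope.

Set Implicit Arguments.
Unset Strict Implicit.
Unset Printing Implicit Defensive.

(** * Affine changes of variable for the completed Lebesgue measure *)

Section affine_change_of_variable.
Context {R : realType}.
Local Notation mu := (@completed_lebesgue_measure R).
Local Notation L := (lebesgueTypeR R).

Let affine_preimage_le (w k : R) (X : set R) : 0 < w ->
  (mu ((fun x => w * x - k)%R @^-1` X) <= (w^-1)%:E * mu X)%E.
Proof.
move=> w0; rewrite lee_pdivlMl//.
apply: le_ereal_inf_tmp => _ [A [mA XA] <-].
rewrite -lee_pdivlMl//.
rewrite -nneseriesZl; last by move=> n _; exact: measure_ge0.
apply: ereal_inf_lbound.
exists (fun n => (fun x => w * x - k) @^-1` (A n)).
  split; last by move=> x /XA[n _ An]; exists n.
  move=> n; have [[a b] _ /= <-] := mA n.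
  exists ((a + k) / w, (b + k) / w) => //=.
  apply/seteqP; split=> x /=; rewrite !in_itv/= ltr_pdivrMr// ler_pdivlMr//; lra.
apply: eq_eseriesr => n _.
have [[a b] _ /= <-] := mA n.
have -> : (fun x => w * x - k) @^-1` `]a, b] = `](a + k) / w, (b + k) / w]%classic.
  apply/seteqP; split=> x /=; rewrite !in_itv/= ltr_pdivrMr// ler_pdivlMr//; lra.
rewrite !wlength_itv/= !lte_fin ltr_pM2r ?invr_gt0// ltrD2r.
case: ifP => ab; last by rewrite mule0.
by rewrite -!EFinB -EFinM; congr EFin; field; rewrite gt_eqF.
Qed.

(** The identity holds for every set, measurable or not, as the completed
    measure is the restriction of the outer measure of coverings by half-open
    intervals, and an affine map carries coverings to coverings. *)
Lemma affine_preimage_measure (w k : R) (X : set R) : 0 < w ->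
  mu ((fun x => w * x - k) @^-1` X) = ((w^-1)%:E * mu X)%E.
Proof.
move=> w0; apply/eqP; rewrite eq_le affine_preimage_le//=.
rewrite lee_pdivrMl//.
have wV0 : 0 < w^-1 by rewrite invr_gt0.
have := @affine_preimage_le w^-1 (- k / w) ((fun x => w * x - k) @^-1` X) wV0.
rewrite invrK; apply: le_trans.
rewrite le_eqVlt; apply/orP; left; apply/eqP; congr (mu _).
apply/seteqP; split => x /=; rewrite (_ : w * (w^-1 * x - - k / w) - k = x)//;
  by field; rewrite gt_eqF.
Qed.

(** Caratheodory's condition is transported by the scaling of the outer
    measure; the affine map being Borel would not suffice, as sets that
    are only Lebesgue measurable are pulled back. *)
Lemma measurable_affine (w k : R) : 0 < w ->
  measurable_fun [set: L] ((fun x => w * x - k) : L -> L).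
Proof.
move=> w0 _ A mA; rewrite setTI.
suff : caratheodory_measurable mu ((fun x : R => w * x - k) @^-1` A) by [].
move=> X.
pose T := fun x : R => w * x - k.
pose T' := fun x : R => w^-1 * x - - k / w.
have TT' : cancel T T' by move=> x; rewrite /T /T'; field; rewrite gt_eqF.
have T'T : cancel T' T by move=> x; rewrite /T /T'; field; rewrite gt_eqF.
have E Y : mu Y = ((w^-1)%:E * mu (T' @^-1` Y))%E.
  rewrite -(affine_preimage_measure k)//; congr (mu _).
  by apply/seteqP; split => x /=; rewrite TT'.
have wV0 : (0 <= (w^-1)%:E :> \bar R)%E by rewrite lee_fin invr_ge0 ltW.
rewrite E [in RHS]E [X in (_ + X)%E]E -ge0_muleDr//; congr (_ * _)%E.
have mA' : caratheodory_measurable mu A by exact: mA.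
have := mA' (T' @^-1` X).
have -> : T' @^-1` (X `&` (T @^-1` A)) = T' @^-1` X `&` A.
  by apply/seteqP; split => x /= []; rewrite T'T.
have -> : T' @^-1` (X `&` ~` (T @^-1` A)) = T' @^-1` X `&` ~` A.
  by apply/seteqP; split => x /= []; rewrite T'T.
by [].
Qed.

Lemma measurable_comp_affine d' (V : measurableType d') (F : L -> V) (w k : R) :
  0 < w -> measurable_fun [set: L] F ->
  measurable_fun [set: L] (fun x : L => F (w * x - k)).
Proof.
by move=> w0 mF; exact: (measurableT_comp mF (measurable_affine _ w0)).
Qed.

Lemma ge0_integral_affine (w k : R) (F : L -> \bar R) : 0 < w ->
  measurable_fun [set: L] F -> (forall x, 0 <= F x)%E ->
  (\int[mu]_x F (w * x - k)%R = (w^-1)%:E * \int[mu]_x F x)%E.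
Proof.
move=> w0 mF F0.
have wV0 : 0 <= w^-1 by rewrite invr_ge0 ltW.
have mT := measurable_affine k w0.
have := @ge0_integral_pushforward _ _ _ _ R _ mT mu setT F measurableT mF.
rewrite preimage_setT => <- //.
rewrite (@eq_measure_integral _ _ _ _ (mscale (NngNum wV0) mu)).
  by rewrite ge0_integral_mscale.
by move=> A mA _; exact: affine_preimage_measure.
Qed.

Lemma lebesgue_L1_affine (w k : R) (g : R -> R) : 0 < w ->
  lebesgue_L1 g -> lebesgue_L1 (fun x => g (w * x - k)).
Proof.
move=> w0 /integrableP[mg ig]; apply/integrableP; split.
  exact: (@measurable_comp_affine _ _ (EFin \o g)).
under eq_integral do rewrite /=.
rewrite (@ge0_integral_affine w k (fun x => `|(g x)%:E|)%E)//.
  by rewrite lte_mul_pinfty// lee_fin invr_ge0 ltW.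
exact: measurableT_comp.
Qed.

Lemma Rintegral_affine (w k : R) (g : R -> R) : 0 < w -> lebesgue_L1 g ->
  \int[mu]_x g (w * x - k) = w^-1 * \int[mu]_x g x.
Proof.
move=> w0 ig; have mg := measurable_int _ ig.
rewrite /Rintegral -[LHS]/(fine _) integralE [in RHS]integralE.
have p : (\int[mu]_x (EFin \o (fun x => g (w * x - k)%R))^\+ x =
  (w^-1)%:E * \int[mu]_x (EFin \o g)^\+ x)%E.
  rewrite -(ge0_integral_affine k w0 (measurable_funepos mg))//.
  by apply: eq_integral => x _; rewrite !funeposE.
have n : (\int[mu]_x (EFin \o (fun x => g (w * x - k)%R))^\- x =
  (w^-1)%:E * \int[mu]_x (EFin \o g)^\- x)%E.
  rewrite -(ge0_integral_affine k w0 (measurable_funeneg mg))//.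
  by apply: eq_integral => x _; rewrite !funenegE.
have fp : (\int[mu]_x (EFin \o g)^\+ x)%E \is a fin_num.
  exact: (integrable_pos_fin_num measurableT ig).
have fn : (\int[mu]_x (EFin \o g)^\- x)%E \is a fin_num.
  exact: (integrable_neg_fin_num measurableT ig).
rewrite p n -muleBr//; last exact: fin_num_adde_defr.
by rewrite fineM// fin_numB fp fn.
Qed.

End affine_change_of_variable.

(** * Summation over the integers *)

Section sums_over_int.
Context {R : realType}.
Implicit Types F G : int -> \bar R.
Local Open Scope ereal_scope.

(** This expresses an unordered sum as a series, for which monotone convergence
    and Tonelli's theorem are stated. *)
Lemma esum_int F : (forall k, 0 <= F k) ->
  \esum_(k in [set: int]) F k = \sum_(n <oo) (F (Posz n) + F (Negz n)).
Proof.
move=> F0; rewrite nneseriesD//.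
have rangeE (e : nat -> int) : injective e ->
    \esum_(k in range e) F k = \sum_(n <oo) F (e n).
  by move=> ei; rewrite esum_image ?nneseries_esumT// => m n _ _ /ei.
rewrite (esumID (range Posz))// !setTI; congr (_ + _).
  by rewrite rangeE// => m n [].
have -> : ~` range Posz = range Negz.
  apply/seteqP; split => [[n|n]/= nP|_ [n _ <-] [m _]]//; last by exists n.
  by exfalso; apply: nP; exists n.
by rewrite rangeE// => m n [].
Qed.

Lemma esum_intZl (r : R) F : (0 <= r)%R -> (forall k, 0 <= F k) ->
  \esum_(k in [set: int]) (r%:E * F k) = r%:E * \esum_(k in [set: int]) F k.
Proof.
move=> r0 F0; rewrite !esum_int//; last first.
  by move=> k; rewrite mule_ge0.
rewrite -nneseriesZl; last by move=> n _; rewrite adde_ge0.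
by apply: eq_eseriesr => n _; rewrite ge0_muleDr.
Qed.

Lemma measurable_esum_int d (T : measurableType d) (F : int -> T -> \bar R) :
  (forall k x, 0 <= F k x) -> (forall k, measurable_fun [set: T] (F k)) ->
  measurable_fun [set: T] (fun x => \esum_(k in [set: int]) F k x).
Proof.
move=> F0 mF; under eq_fun do rewrite esum_int//.
apply: ge0_emeasurable_sum.
- by move=> n x _ _; rewrite adde_ge0.
- by move=> n _; apply: emeasurable_funD.
Qed.

Lemma ge0_integral_esum_int d (T : measurableType d)
    (mu : {measure set T -> \bar R}) (F : int -> T -> \bar R) :
  (forall k x, 0 <= F k x) -> (forall k, measurable_fun [set: T] (F k)) ->
  \int[mu]_x (\esum_(k in [set: int]) F k x) =
  \esum_(k in [set: int]) \int[mu]_x F k x.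
Proof.
move=> F0 mF; rewrite esum_int; last by move=> k; exact: integral_ge0.
under eq_integral do rewrite esum_int//.
rewrite integral_nneseries//; last 2 first.
- by move=> n; exact: emeasurable_funD.
- by move=> n x _; rewrite adde_ge0.
by apply: eq_eseriesr => n _; rewrite ge0_integralD.
Qed.

Lemma esum_int_ge_term F k0 : (forall k, 0 <= F k) ->
  F k0 <= \esum_(k in [set: int]) F k.
Proof.
move=> F0; apply: esum_ge; exists [set k0]; first by split.
by rewrite fsbig_set1.
Qed.

(** An absolutely convergent family makes both halves of the two-sided series
    converge, so the conventional sum is controlled by the unordered one. *)
Lemma zseries_summable (a : int -> R) :
  \esum_(k in [set: int]) `|a k|%:E < +oo ->
  zseries_cvg a /\ `|zsum a|%:E <= \esum_(k in [set: int]) `|a k|%:E.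
Proof.
rewrite esum_int//; rewrite nneseriesD// => ay.
have p0 : 0 <= \sum_(n <oo) `|a (Posz n)|%:E by exact: nneseries_ge0.
have n0 : 0 <= \sum_(n <oo) `|a (Negz n)|%:E by exact: nneseries_ge0.
have /nnseries_is_cvg cp : \sum_(n <oo) `|a (Posz n)|%:E < +oo.
  by apply: le_lt_trans ay; rewrite leeDl.
have /nnseries_is_cvg cn : \sum_(n <oo) `|a (Negz n)|%:E < +oo.
  by apply: le_lt_trans ay; rewrite leeDr.
have {}cp := cp (fun=> normr_ge0 _); have {}cn := cn (fun=> normr_ge0 _).
split; first by split; exact: normed_cvg.
have E (u : R ^nat) : cvgn [normed series u] ->
    \sum_(n <oo) `|u n|%:E = (limn [normed series u])%:E :> \bar R.
  move=> cu; rewrite -EFin_lim//; congr (limn _).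
  by apply/funext => n /=; rewrite -sumEFin.
rewrite (E (a \o Posz))// (E (a \o Negz))// -EFinD lee_fin /zsum.
by apply: (le_trans (ler_normD _ _)); apply: lerD; exact: lim_series_norm.
Qed.

Lemma zsumB (a b : int -> R) : zseries_cvg a -> zseries_cvg b ->
  zsum (fun k => a k - b k)%R = (zsum a - zsum b)%R.
Proof.
move=> [ap an] [bp bn]; rewrite /zsum.
rewrite [X in (X + _)%R = _](lim_seriesB ap bp).
rewrite [X in (_ + X)%R = _](lim_seriesB an bn).
by rewrite opprD addrACA.
Qed.

Lemma zsumMr (a : int -> R) (c : R) : zseries_cvg a ->
  zseries_cvg (fun k => a k * c)%R /\ zsum (fun k => a k * c)%R = (zsum a * c)%R.
Proof.
move=> [ap an].
have E (u : nat -> R) : (fun n => u n * c)%R = c *: u.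
  by apply/funext => n; rewrite mulrC.
split.
  by split; rewrite /= (E (fun n => a _)); exact: is_cvg_seriesZ.
rewrite /zsum mulrDl (E (fun n => a (Posz n))) (E (fun n => a (Negz n))).
by rewrite !lim_seriesZ// ![c *: _]mulrC.
Qed.

End sums_over_int.

(** * Integer translates of a kernel *)

Section integer_counting.
Context {R : realType}.

(** The integers of ]p, q] are those of ]floor p, floor q], and
    floor q - floor p < q - p + 1. *)
Lemma count_int_itv_le (p q : R) : p <= q ->
  (\esum_(k in [set: int]) ((p < k%:~R <= q)%R%:R)%:E <= (q - p + 1)%:E)%E.
Proof.
move=> pq; set a := Num.floor p; set b := Num.floor q.
have ab : a <= b by exact: le_floor.
pose e (i : nat) : int := a + 1 + i%:Z.
have -> : (\esum_(k in [set: int]) ((p < k%:~R <= q)%R%:R)%:E =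
    \esum_(k in e @` `I_`|(b - a)%R|%N) (1%:E : \bar R))%E.
  rewrite [RHS]esum_mkcond; apply: eq_esum => k _.
  have -> : (p < k%:~R <= q) = (a < k <= b).
    by rewrite /a /b floor_lt_int floor_ge_int.
  case: ifPn => [/set_mem[i /= ilt <-]|/negP kN].
    by rewrite (_ : (_ < _ <= _)%R)// /e; lia.
  case: (boolP (a < k <= b)) => // akb; exfalso; apply: kN; apply/mem_set.
  by exists `|(k - a - 1)%R|%N; rewrite /e/=; lia.
rewrite esum_image; last by move=> i j _ _; rewrite /e; lia.
rewrite esum_fset//= -fsbig_ord/= sumEFin lee_fin sumr_const card_ord.
have -> : (1 : R) *+ `|(b - a)%R|%N = (b - a)%:~R.
  by rewrite -[in RHS](@gez0_abs (b - a)) ?subr_ge0// pmulrn.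
rewrite intrD mulrNz.
have := floor_le q; have := floorD1_gt p; rewrite -/a -/b intrD.
lra.
Qed.

End integer_counting.

Section periodization.
Context {R : realType}.
Implicit Types g : R -> R.

Lemma abs_moment0_bound g : (abs_moment 0 g < +oo)%E ->
  exists A : R, forall u : R,
    (\esum_(k in [set: int]) `|g (u - k%:~R)|%:E <= A%:E)%E.
Proof.
move=> gy.
have le u : (\esum_(k in [set: int]) `|g (u - k%:~R)|%:E <= abs_moment 0 g)%E.
  apply: ereal_sup_ubound; exists u => //.
  by apply: eq_esum => k _; rewrite powRr0 mulr1.
exists (fine (abs_moment 0 g)) => u.
rewrite fineK// ge0_fin_numE//.
by apply: le_trans (le 0); exact: esum_ge0.
Qed.

(** Boundedness near 0 is what controls the terms with u - k close to 0, where
    the weight |u - k| ^ r of the moment degenerates. *)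
Lemma abs_moment_bound g (r : R) : 0 < r -> bounded_near g (nbhs (0 : R)) ->
  (abs_moment r g < +oo)%E ->
  exists A : R, forall u : R,
    (\esum_(k in [set: int]) `|g (u - k%:~R)|%:E <= A%:E)%E.
Proof.
move=> r0 /ex_bound[M /nbhs_ballP[d /= d0 gM]] gy.
have le u : (\esum_(k in [set: int])
    (`|g (u - k%:~R)| * `|u - k%:~R| `^ r)%:E <= abs_moment r g)%E.
  by apply: ereal_sup_ubound; exists u.
have [m m0 mE] : exists2 m : R, 0 <= m & abs_moment r g = m%:E.
  exists (fine (abs_moment r g)).
    apply: fine_ge0; apply: le_trans (le 0); apply: esum_ge0 => k _.
    by rewrite lee_fin mulr_ge0// powR_ge0.
  rewrite fineK// ge0_fin_numE//; apply: le_trans (le 0); apply: esum_ge0 => k _.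
  by rewrite lee_fin mulr_ge0// powR_ge0.
have dr0 : 0 < d `^ r by exact: powR_gt0.
have M0 : 0 <= `|M| by [].
(* At most 2 d + 1 integers k have |u - k| < d, and elsewhere
   |u - k| ^ r >= d ^ r. *)
exists (`|M| * (2 * d + 1) + (d `^ r)^-1 * m) => u.
apply: (@le_trans _ _ (\esum_(k in [set: int])
   (`|M|%:E * ((u - d < k%:~R <= u + d)%R%:R)%:E +
    ((d `^ r)^-1)%:E * (`|g (u - k%:~R)| * `|u - k%:~R| `^ r)%:E))%E).
  apply: le_esum => k _; rewrite -!EFinM -EFinD lee_fin.
  have ge0 : 0 <= `|g (u - k%:~R)| by [].
  have [ukd|ukd] := ltP `|u - k%:~R| d.
    have -> : u - d < k%:~R <= u + d by move: ukd; rewrite ltr_norml; lra.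
    have gle : `|g (u - k%:~R)| <= M.
      by apply: gM; rewrite /ball/= sub0r normrN.
    apply: (@le_trans _ _ (`|M|)); first by rewrite (le_trans gle)// ler_norm.
    by rewrite mulr1 lerDl !mulr_ge0 ?invr_ge0 ?powR_ge0.
  rewrite -[leLHS]add0r; apply: lerD; first by rewrite mulr_ge0.
  rewrite mulrCA ler_peMr// mulrC ler_pdivlMr// mul1r.
  by apply: ge0_ler_powR; rewrite ?nnegrE// ltW.
rewrite esumD; last 2 first.
- by move=> k _; rewrite -EFinM lee_fin mulr_ge0.
- move=> k _; by rewrite -EFinM lee_fin !mulr_ge0 ?invr_ge0 ?powR_ge0.
rewrite !esum_intZl//; last by rewrite invr_ge0 ltW.
rewrite EFinD !EFinM; apply: leeD.
  apply: lee_wpmul2l; first by rewrite lee_fin.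
  have ud : u - d <= u + d by lra.
  by apply: (le_trans (count_int_itv_le ud)); rewrite lee_fin; lra.
apply: lee_wpmul2l; first by rewrite lee_fin invr_ge0 ltW.
by rewrite -mE.
Qed.

Lemma periodization_pointwise g (A : R) :
  (forall u : R, (\esum_(k in [set: int]) `|g (u - k%:~R)|%:E <= A%:E)%E) ->
  forall u, `|g u| <= A.
Proof.
move=> gA u; rewrite -lee_fin; apply: le_trans (gA u).
have := @esum_int_ge_term R (fun k : int => `|g (u - k%:~R)|%:E) 0.
by rewrite subr0; apply => k; rewrite lee_fin.
Qed.

End periodization.

(** * The exponential Young function *)

Section exponential_young_function.
Context {R : realType} (alpha : R).
Hypothesis alpha_ge1 : 1 <= alpha.

Definition eta (t : R) : R := expR (t `^ alpha) - 1.

(** The odd function equal to eta (2 t) on t >= 0; the two terms have disjoint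
    supports, which makes it visibly measurable. *)
Definition signed_eta (t : R) : R :=
  eta (2 * Num.max t 0) - eta (2 * Num.max (- t) 0).

Let alpha_gt0 : 0 < alpha. Proof. exact: lt_le_trans alpha_ge1. Qed.

Lemma powR_le_eta t : t `^ alpha <= eta t.
Proof. by rewrite /eta lerBrDl expR_ge1Dx. Qed.

Lemma eta_ge0 t : 0 <= eta t.
Proof. by apply: le_trans (powR_le_eta t); exact: powR_ge0. Qed.

Lemma eta0 : eta 0 = 0.
Proof. by rewrite /eta powR0 ?gt_eqF// expR0 subrr. Qed.

Lemma le_eta s t : 0 <= s -> s <= t -> eta s <= eta t.
Proof.
move=> s0 st; rewrite lerD2r ler_expR ge0_ler_powR ?nnegrE ?(ltW alpha_gt0)//.
exact: le_trans st.
Qed.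

(** For x, y >= 0 one has exp (x + y) - 1 >= (exp x - 1) + (exp y - 1), and the
    power alpha >= 1 is superadditive too. *)
Lemma eta_superadditive s d : 0 <= s -> 0 <= d -> eta s + eta d <= eta (s + d).
Proof.
move=> s0 d0; rewrite /eta.
have sd : s `^ alpha + d `^ alpha <= (s + d) `^ alpha.
  rewrite -!(mulr_powRB1 _ alpha_gt0) ?addr_ge0// mulrDl.
  have a0 : 0 <= alpha - 1 by rewrite subr_ge0.
  have sd0 : 0 <= s + d by exact: addr_ge0.
  apply: lerD; apply: ler_wpM2l => //; apply: (ge0_ler_powR a0) => //.
    by rewrite lerDl.
  by rewrite lerDr.
have e1 (x : R) : 0 <= x -> 0 <= expR x - 1.
  by move=> x0; rewrite subr_ge0 (le_trans _ (expR_ge1Dx x))// lerDl.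
have : expR (s `^ alpha + d `^ alpha) <= expR ((s + d) `^ alpha).
  by rewrite ler_expR.
have := mulr_ge0 (e1 _ (powR_ge0 s alpha)) (e1 _ (powR_ge0 d alpha)).
rewrite expRD; move: (expR _) (expR _) (expR _) => x y z.
lra.
Qed.

(* Bernoulli's inequality, deduced from Young's inequality for v / T and 1 with
   exponents alpha and alpha / (alpha - 1). *)
Let powR_ge_tangent (v T : R) : 0 <= v -> 0 < T ->
  T `^ alpha + alpha * T `^ (alpha - 1) * (v - T) <= v `^ alpha.
Proof.
move=> v0 T0; have T0' := ltW T0.
have [->|a1] := eqVneq alpha 1.
  by rewrite subrr powRr0 !powRr1//; lra.
have {}a1 : 1 < alpha by rewrite lt_neqAle eq_sym a1.
have x0 : 0 <= v / T by rewrite divr_ge0.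
have young := @conjugate_powR R (v / T) 1 alpha (alpha / (alpha - 1)) x0 ler01
  alpha_gt0.
have q0 : 0 < alpha / (alpha - 1) by rewrite divr_gt0// subr_gt0.
have pq : alpha^-1 + (alpha / (alpha - 1))^-1 = 1.
  by field; rewrite subr_eq0 !gt_eqF.
have {young} := young q0 pq.
rewrite mulr1 powR1 => young.
have E : v `^ alpha = (v / T) `^ alpha * T `^ alpha.
  by rewrite -powRM// divfK// gt_eqF.
have ET : T `^ alpha = T * T `^ (alpha - 1) by rewrite mulr_powRB1.
have TP : 0 < T `^ (alpha - 1) by exact: powR_gt0.
have {}young : alpha * (v / T) <= (v / T) `^ alpha + (alpha - 1).
  have : alpha * (v / T) <=
      alpha * ((v / T) `^ alpha / alpha + 1 / (alpha / (alpha - 1))).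
    by rewrite ler_pM2l.
  move=> /le_trans; apply; rewrite le_eqVlt; apply/orP; left; apply/eqP.
  by field; rewrite subr_eq0 !gt_eqF.
rewrite E ET.
have -> : T * T `^ (alpha - 1) + alpha * T `^ (alpha - 1) * (v - T) =
   (1 + alpha * (v / T) - alpha) * (T * T `^ (alpha - 1)).
  by field; rewrite gt_eqF.
by apply: ler_wpM2r; [rewrite mulr_ge0// ltW|lra].
Qed.

(** The slope m is the derivative of eta at T.  As eta 0 = 0, the affine minorant
    m v - c has a nonpositive constant term, which is why Jensen's inequality
    will hold for weights whose total mass is only bounded from above. *)
Lemma eta_supporting_line (T : R) : 0 <= T -> exists m c : R,
  [/\ 0 <= m, 0 <= c, c = m * T - eta T &
      forall v, 0 <= v -> m * v <= eta v + c].
Proof.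
rewrite le_eqVlt => /predU1P[<-|T0].
  exists 0, 0; split=> //; first by rewrite mul0r eta0 subr0.
  by move=> v v0; rewrite mul0r addr0 eta_ge0.
set m := alpha * T `^ (alpha - 1) * expR (T `^ alpha).
have m0 : 0 <= m by rewrite !mulr_ge0 ?powR_ge0 ?expR_ge0// ltW.
have line v : 0 <= v -> m * v <= eta v + (m * T - eta T).
  move=> v0.
  have E0 := expR_gt0 (T `^ alpha).
  have tangent := powR_ge_tangent v0 T0.
  have slope : m * (v - T) <= expR (T `^ alpha) * (v `^ alpha - T `^ alpha).
    rewrite /m mulrAC mulrC; apply: ler_wpM2l; first exact: expR_ge0.
    by rewrite lerBrDl.
  have : expR (T `^ alpha) * (1 + (v `^ alpha - T `^ alpha)) <=
      expR (v `^ alpha).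
    rewrite -[X in _ <= expR X](subrKC (T `^ alpha)) expRD ler_pM2l//.
    exact: expR_ge1Dx.
  rewrite mulrDr mulr1 => /(le_trans (lerD (lexx _) slope)).
  rewrite mulrBr /eta; lra.
exists m, (m * T - eta T); split=> //.
by have := line 0 (lexx 0); rewrite mulr0 eta0 add0r.
Qed.

Opaque eta.

Lemma signed_eta_ge0E t : 0 <= t -> signed_eta t = eta (2 * t).
Proof.
move=> t0; rewrite /signed_eta (max_l t0) (max_r (y := 0)) ?oppr_le0//.
by rewrite mulr0 eta0 [LHS]subr0.
Qed.

Lemma signed_eta_le0E t : t <= 0 -> signed_eta t = - eta (2 * - t).
Proof.
move=> t0; rewrite /signed_eta (max_r t0) (max_l (x := - t)) ?oppr_ge0//.
by rewrite mulr0 eta0 [LHS]sub0r.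
Qed.

Lemma norm_signed_eta t : `|signed_eta t| = eta (2 * `|t|).
Proof.
have /orP[t0|t0] := le_total 0 t.
  by rewrite (signed_eta_ge0E t0) (ger0_norm (eta_ge0 _)) (ger0_norm t0).
by rewrite (signed_eta_le0E t0) normrN (ger0_norm (eta_ge0 _)) (ler0_norm t0).
Qed.

(** For arguments of the same sign this is superadditivity; for arguments of
    opposite signs a - b is at most twice the larger of |a| and |b|, which
    explains the factor 2 in signed_eta. *)
Lemma eta_sub_le a b : b <= a -> eta (a - b) <= signed_eta a - signed_eta b.
Proof.
move=> ba.
have sup s d : 0 <= s -> 0 <= d -> eta d <= eta (2 * (s + d)) - eta (2 * s).
  move=> s0 d0; rewrite lerBrDl mulrDr.
  apply: le_trans (eta_superadditive _ _); rewrite ?mulr_ge0//.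
  by rewrite lerD2l le_eta//; lra.
have /orP[b0|b0] := le_total 0 b.
  have a0 := le_trans b0 ba.
  rewrite (signed_eta_ge0E a0) (signed_eta_ge0E b0).
  by have := sup b (a - b) b0; rewrite subr_ge0 => /(_ ba); rewrite subrKC.
rewrite (signed_eta_le0E b0) (opprK (eta (2 * - b))).
have /orP[a0|a0] := le_total 0 a; last first.
  rewrite (signed_eta_le0E a0).
  have := sup (- a) (a - b); rewrite oppr_ge0 subr_ge0 => /(_ a0 ba).
  have -> : - a + (a - b) = - b by ring.
  by rewrite [- eta _ + _]addrC.
rewrite (signed_eta_ge0E a0).
have [ab|ab] := lerP a (- b).
  apply: (@le_trans _ _ (eta (2 * - b))); first by apply: le_eta; lra.
  by rewrite lerDr eta_ge0.
apply: (@le_trans _ _ (eta (2 * a))); first by apply: le_eta; lra.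
by rewrite lerDl eta_ge0.
Qed.

(** The increments of eta o f are dominated by those of one function
    signed_eta o f, which is what reduces the exponential space to L1. *)
Lemma eta_dist_le a b : eta `|a - b| <= `|signed_eta a - signed_eta b|.
Proof.
have /orP[ba|ab] := le_total b a.
  rewrite (@ger0_norm _ (a - b)); last by rewrite subr_ge0.
  exact: le_trans (eta_sub_le ba) (ler_norm _).
rewrite (distrC a b) (@ger0_norm _ (b - a)); last by rewrite subr_ge0.
apply: (le_trans (eta_sub_le ab)).
by rewrite (distrC (signed_eta a) (signed_eta b)); exact: ler_norm.
Qed.

Transparent eta.

End exponential_young_function.

(** * Iterated integrals *)

Section iterated_integrals.
Context {R : realType}.
Local Notation mu := (@completed_lebesgue_measure R).
Local Notation L := (lebesgueTypeR R).
Local Open Scope ereal_scope.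

Lemma measurable_fun_integral2 (G : R -> R -> \bar R) :
  measurable_fun [set: (L * L)%type] (fun p : L * L => G p.1 p.2) ->
  (forall x u, 0 <= G x u) ->
  measurable_fun [set: L] (fun x : L => \int[mu]_u G x u).
Proof.
move=> mG G0.
apply: (@measurable_fun_fubini_tonelli_F _ _ L L R mu
  (fun p : L * L => G p.1 p.2)) => //.
Qed.

Lemma measurable_section (G : R -> R -> \bar R) (x : L) :
  measurable_fun [set: (L * L)%type] (fun p : L * L => G p.1 p.2) ->
  measurable_fun [set: L] (G x).
Proof.
by move=> mG; exact: (measurableT_comp mG (pair1_measurable x)).
Qed.

Lemma measurable_comp_fst (g : R -> R) : measurable_fun [set: L] g ->
  measurable_fun [set: (L * L)%type] (fun p : L * L => g p.1).
Proof. by move=> mg; exact: (measurableT_comp mg (@measurable_fst _ _ L L)). Qed.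

Lemma measurable_comp_snd (g : R -> R) : measurable_fun [set: L] g ->
  measurable_fun [set: (L * L)%type] (fun p : L * L => g p.2).
Proof. by move=> mg; exact: (measurableT_comp mg (@measurable_snd _ _ L L)). Qed.

Lemma ge0_le_integral2 (G H : R -> R -> \bar R) :
  measurable_fun [set: (L * L)%type] (fun p : L * L => G p.1 p.2) ->
  measurable_fun [set: (L * L)%type] (fun p : L * L => H p.1 p.2) ->
  (forall x u, 0 <= G x u) -> (forall x u, G x u <= H x u) ->
  \int[mu]_x \int[mu]_u G x u <= \int[mu]_x \int[mu]_u H x u.
Proof.
move=> mG mH G0 GH.
have H0 x u : 0 <= H x u by exact: le_trans (GH x u).
apply: ge0_le_integral.
- by [].
- by move=> x _; exact: integral_ge0.
- exact: measurable_fun_integral2.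
- exact: measurable_fun_integral2.
move=> x _; apply: ge0_le_integral.
- by [].
- by move=> u _; exact: G0.
- exact: measurable_section.
- exact: measurable_section.
- by move=> u _; exact: GH.
Qed.

Lemma ge0_integralD2 (G H : R -> R -> \bar R) :
  measurable_fun [set: (L * L)%type] (fun p : L * L => G p.1 p.2) ->
  measurable_fun [set: (L * L)%type] (fun p : L * L => H p.1 p.2) ->
  (forall x u, 0 <= G x u) -> (forall x u, 0 <= H x u) ->
  \int[mu]_x \int[mu]_u (G x u + H x u) =
  \int[mu]_x \int[mu]_u G x u + \int[mu]_x \int[mu]_u H x u.
Proof.
move=> mG mH G0 H0; rewrite -ge0_integralD.
- apply: eq_integral => x _; rewrite ge0_integralD.
  + by [].
  + by [].
  + by move=> u _; exact: G0.
  + exact: measurable_section.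
  + by move=> u _; exact: H0.
  + exact: measurable_section.
- by [].
- by move=> x _; exact: integral_ge0.
- exact: measurable_fun_integral2.
- by move=> x _; exact: integral_ge0.
- exact: measurable_fun_integral2.
Qed.

Lemma ge0_integralZl2 (c : R) (G : R -> R -> \bar R) : (0 <= c)%R ->
  measurable_fun [set: (L * L)%type] (fun p : L * L => G p.1 p.2) ->
  (forall x u, 0 <= G x u) ->
  \int[mu]_x \int[mu]_u (c%:E * G x u) = c%:E * \int[mu]_x \int[mu]_u G x u.
Proof.
move=> c0 mG G0; rewrite -ge0_integralZl_EFin.
- apply: eq_integral => x _; rewrite ge0_integralZl_EFin.
  + by [].
  + by [].
  + by move=> u _; exact: G0.
  + exact: measurable_section.
  + by [].
- by [].
- by move=> x _; exact: integral_ge0.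
- exact: measurable_fun_integral2.
- by [].
Qed.

Lemma integral2_tensor (a b : R -> R) :
  measurable_fun [set: L] a -> measurable_fun [set: L] b ->
  (forall x, 0 <= a x)%R -> (forall x, 0 <= b x)%R ->
  \int[mu]_x \int[mu]_u (a x * b u)%:E =
  (\int[mu]_x (a x)%:E) * (\int[mu]_u (b u)%:E).
Proof.
move=> ma mb a0 b0.
transitivity (\int[mu]_x ((a x)%:E * \int[mu]_u (b u)%:E)).
  apply: eq_integral => x _; rewrite -ge0_integralZl_EFin.
  - by [].
  - by [].
  - by move=> u _; rewrite lee_fin.
  - exact/measurable_EFinP.
  - by [].
rewrite ge0_integralZr.
- by [].
- by [].
- exact/measurable_EFinP.
- by move=> x _; rewrite lee_fin.
- by apply: integral_ge0 => u _; rewrite lee_fin.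
Qed.

Lemma ge0_integral2_esum_int (G : int -> R -> R -> \bar R) :
  (forall k, measurable_fun [set: (L * L)%type]
     (fun p : L * L => G k p.1 p.2)) ->
  (forall k x u, 0 <= G k x u) ->
  \esum_(k in [set: int]) \int[mu]_x \int[mu]_u G k x u =
  \int[mu]_x \int[mu]_u (\esum_(k in [set: int]) G k x u).
Proof.
move=> mG G0; rewrite -ge0_integral_esum_int.
- apply: eq_integral => x _; rewrite ge0_integral_esum_int.
  + by [].
  + by move=> k u; exact: G0.
  + by move=> k; exact: measurable_section.
- by move=> k x; exact: integral_ge0.
- by move=> k; exact: measurable_fun_integral2.
Qed.

End iterated_integrals.

(** * The oscillation functional *)

Section oscillation.
Context {R : realType}.
Local Notation mu := (@completed_lebesgue_measure R).
Local Notation L := (lebesgueTypeR R).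
Variables (phi psi : R -> R).
Hypotheses (mphi : measurable_fun [set: L] phi)
  (mpsi : measurable_fun [set: L] psi).
Implicit Types h : R -> R.

Definition osc_density (w : R) h (k : int) (x u : R) : R :=
  `|phi (w * x - k%:~R)| * (w * `|psi (w * u - k%:~R)|) * `|h u - h x|.

(** The oscillation of h seen by the operators at scale w: the integral of
    |h u - h x| against the kernel sum_k |phi (w x - k)| w |psi (w u - k)|. *)
Definition osc (w : R) h : \bar R :=
  (\esum_(k in [set: int])
    \int[mu]_x \int[mu]_u (osc_density w h k x u)%:E)%E.

Lemma oscE w h : osc w h = (\esum_(k in [set: int])
    \int[mu]_x \int[mu]_u (osc_density w h k x u)%:E)%E.
Proof. by []. Qed.

Lemma osc_density_ge0 w h k x u : 0 < w -> 0 <= osc_density w h k x u.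
Proof. by move=> w0; rewrite !mulr_ge0// ltW. Qed.

Lemma measurable_norm_affine (g : R -> R) (w k : R) : 0 < w ->
  measurable_fun [set: L] g ->
  measurable_fun [set: L] (fun x : L => `|g (w * x - k)|).
Proof.
move=> w0 mg.
exact: (measurableT_comp (@normr_measurable R setT)
  (measurable_comp_affine k w0 mg)).
Qed.

Lemma measurable_osc_density w h k : 0 < w -> measurable_fun [set: L] h ->
  measurable_fun [set: (L * L)%type]
    (fun p : L * L => (osc_density w h k p.1 p.2)%:E).
Proof.
move=> w0 mh; apply/measurable_EFinP.
apply: measurable_funM; first apply: measurable_funM.
- exact: (measurable_comp_fst (measurable_norm_affine k%:~R w0 mphi)).
- apply: measurable_funM; first exact: measurable_cst.
  exact: (measurable_comp_snd (measurable_norm_affine k%:~R w0 mpsi)).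
- apply: (measurableT_comp (@normr_measurable R setT)); apply: measurable_funB.
    exact: (measurable_comp_snd mh).
  exact: (measurable_comp_fst mh).
Qed.

(** Stated for any h whose increments are dominated by those of h1 and h2, so
    that it applies to sums, multiples and unions alike. *)
Lemma osc_sublinear w h h1 h2 (c1 c2 : R) : 0 < w -> 0 <= c1 -> 0 <= c2 ->
  measurable_fun [set: L] h -> measurable_fun [set: L] h1 ->
  measurable_fun [set: L] h2 ->
  (forall x u, `|h u - h x| <= c1 * `|h1 u - h1 x| + c2 * `|h2 u - h2 x|) ->
  (osc w h <= c1%:E * osc w h1 + c2%:E * osc w h2)%E.
Proof.
move=> w0 c10 c20 mh mh1 mh2 hle.
have I0 g k : (0 <= \int[mu]_x \int[mu]_u (osc_density w g k x u)%:E)%E.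
  apply: integral_ge0 => x _; apply: integral_ge0 => u _.
  by rewrite lee_fin osc_density_ge0.
rewrite -!esum_intZl//.
rewrite -esumD; try by move=> k _; rewrite mule_ge0.
apply: le_esum => k _.
have m1 := measurable_osc_density k w0 mh1.
have m2 := measurable_osc_density k w0 mh2.
have D0 g x u : (0 <= (osc_density w g k x u)%:E)%E.
  by rewrite lee_fin osc_density_ge0.
have mM c g : measurable_fun [set: (L * L)%type]
      (fun p : L * L => (osc_density w g k p.1 p.2)%:E) ->
    measurable_fun [set: (L * L)%type]
      (fun p : L * L => c%:E * (osc_density w g k p.1 p.2)%:E)%E.
  by move=> mg; apply: emeasurable_funM.
have M0 c g x u : 0 <= c -> (0 <= c%:E * (osc_density w g k x u)%:E)%E.
  by move=> c0; rewrite mule_ge0.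
rewrite -!ge0_integralZl2//.
rewrite -ge0_integralD2//; try (by move=> *; exact: M0); try exact: mM.
apply: ge0_le_integral2 => //.
- exact: measurable_osc_density.
- by apply: emeasurable_funD; exact: mM.
move=> x u; rewrite -!EFinM -EFinD lee_fin /osc_density.
rewrite ![in leRHS](mulrCA _ (_ * _)) -mulrDr ler_wpM2l//.
by rewrite !mulr_ge0// ltW.
Qed.

Lemma osc_subadditive w h h1 h2 : 0 < w ->
  measurable_fun [set: L] h -> measurable_fun [set: L] h1 ->
  measurable_fun [set: L] h2 ->
  (forall x u, `|h u - h x| <= `|h1 u - h1 x| + `|h2 u - h2 x|) ->
  (osc w h <= osc w h1 + osc w h2)%E.
Proof.
move=> w0 mh mh1 mh2 hle.
have := @osc_sublinear w h h1 h2 1 1 w0 ler01 ler01 mh mh1 mh2.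
move: (osc w h) (osc w h1) (osc w h2) => x y z; rewrite !mul1e; apply.
by move=> s t; rewrite !mul1r.
Qed.

End oscillation.

Section oscillation_bound.
Context {R : realType}.
Local Notation mu := (@completed_lebesgue_measure R).
Local Notation L := (lebesgueTypeR R).

Lemma lebesgue_L1P (g : R -> R) : lebesgue_L1 g ->
  measurable_fun [set: L] g /\
  exists2 c : R, 0 <= c & (\int[mu]_x (`|g x|)%:E = c%:E)%E.
Proof.
move=> ig; split; first exact/measurable_EFinP/(measurable_int mu ig).
have /integrableP[_ igy] := ig.
have I0 : (0 <= \int[mu]_x (`|g x|)%:E)%E by apply: integral_ge0 => x _.
exists (fine (\int[mu]_x (`|g x|)%:E)); first exact: fine_ge0.
by rewrite fineK// ge0_fin_numE.
Qed.

Lemma integral_norm_affine (g : R -> R) (w k : R) : 0 < w ->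
  measurable_fun [set: L] g ->
  (\int[mu]_x (`|g (w * x - k)|)%:E = (w^-1)%:E * \int[mu]_x (`|g x|)%:E)%E.
Proof.
move=> w0 mg.
rewrite -(@ge0_integral_affine R w k (fun x => (`|g x|)%:E)).
- by [].
- by [].
- apply/measurable_EFinP.
  exact: (measurableT_comp (@normr_measurable R setT) mg).
- by move=> x; rewrite lee_fin.
Qed.

Lemma measurable_norm (g : R -> R) : measurable_fun [set: L] g ->
  measurable_fun [set: L] (fun x : L => `|g x|).
Proof. by move=> mg; exact: (measurableT_comp (@normr_measurable R setT) mg). Qed.

Lemma periodized_integral_le (g h : R -> R) (A w : R) : 0 < w ->
  (forall u : R, (\esum_(k in [set: int]) `|g (u - k%:~R)|%:E <= A%:E)%E) ->
  measurable_fun [set: L] g -> measurable_fun [set: L] h ->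
  (\esum_(k in [set: int])
     \int[mu]_u (`|g (w * u - k%:~R)| * `|h u|)%:E
   <= A%:E * \int[mu]_u (`|h u|)%:E)%E.
Proof.
move=> w0 gA mg mh.
have A0 : 0 <= A by apply: le_trans (periodization_pointwise gA 0).
have mF k : measurable_fun [set: L]
    (fun u : L => (`|g (w * u - k%:~R)| * `|h u|)%:E).
  apply/measurable_EFinP; apply: measurable_funM.
    exact: measurable_norm_affine.
  exact: measurable_norm.
have F0 k (u : L) : (0 <= (`|g (w * u - (k : int)%:~R)| * `|h u|)%:E)%E.
  by rewrite lee_fin mulr_ge0.
rewrite -(ge0_integral_esum_int mu F0 mF) -ge0_integralZl_EFin.
- apply: ge0_le_integral.
  + by [].
  + by move=> u _; apply: esum_ge0.
  + exact: (measurable_esum_int F0 mF).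
  + by apply/measurable_EFinP; apply: measurable_funM;
      [exact: measurable_cst|exact: measurable_norm].
  + move=> u _.
    under eq_esum do rewrite mulrC EFinM.
    rewrite esum_intZl// muleC; apply: lee_wpmul2r.
      by rewrite lee_fin.
    exact: gA.
- by [].
- by move=> u _; rewrite lee_fin.
- by apply/measurable_EFinP; exact: measurable_norm.
- by [].
Qed.

Variables (phi psi : R -> R) (A B : R).
Hypotheses (phi_L1 : lebesgue_L1 phi) (psi_L1 : lebesgue_L1 psi).
Hypotheses
  (phiA : forall u : R, (\esum_(k in [set: int]) `|phi (u - k%:~R)|%:E <= A%:E)%E)
  (psiB : forall u : R, (\esum_(k in [set: int]) `|psi (u - k%:~R)|%:E <= B%:E)%E).

(** Split |h u - h x| <= |h u| + |h x|.  In the first term integrate first in x,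
    which leaves the periodization of |psi|; in the second one integrate first
    in u, which leaves the periodization of |phi|. *)
Lemma osc_le_norm : exists2 C : R, 0 <= C &
  forall (w : R) (h : R -> R), 0 < w -> measurable_fun [set: L] h ->
  (osc phi psi w h <= C%:E * \int[mu]_x (`|h x|)%:E)%E.
Proof.
have [mphi [cphi cphi0 Iphi]] := lebesgue_L1P phi_L1.
have [mpsi [cpsi cpsi0 Ipsi]] := lebesgue_L1P psi_L1.
have A0 : 0 <= A by apply: le_trans (periodization_pointwise phiA 0).
have B0 : 0 <= B by apply: le_trans (periodization_pointwise psiB 0).
exists (cphi * B + cpsi * A) => [|w h w0 mh].
  by rewrite addr_ge0 ?mulr_ge0.
have w0' := ltW w0.
have mnphi k := measurable_norm_affine k w0 mphi.
have mnpsi k := measurable_norm_affine k w0 mpsi.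
have mnh := measurable_norm mh.
pose P1 (k : int) (x u : R) :=
  (`|phi (w * x - k%:~R)| * (w * (`|psi (w * u - k%:~R)| * `|h u|)))%:E.
pose P2 (k : int) (x u : R) :=
  ((`|phi (w * x - k%:~R)| * `|h x|) * (w * `|psi (w * u - k%:~R)|))%:E.
have P10 k x u : (0 <= P1 k x u)%E by rewrite lee_fin !mulr_ge0.
have P20 k x u : (0 <= P2 k x u)%E by rewrite lee_fin !mulr_ge0.
have mpsih k : measurable_fun [set: L]
    (fun u : L => w * (`|psi (w * u - k%:~R)| * `|h u|)).
  by apply: measurable_funM; [exact: measurable_cst|exact: measurable_funM].
have mphih k : measurable_fun [set: L]
    (fun x : L => `|phi (w * x - k%:~R)| * `|h x|).
  exact: measurable_funM.
have mwpsi k : measurable_fun [set: L]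
    (fun u : L => w * `|psi (w * u - k%:~R)|).
  by apply: measurable_funM; [exact: measurable_cst|].
have mP1 k : measurable_fun [set: (L * L)%type] (fun p : L * L => P1 k p.1 p.2).
  apply/measurable_EFinP; apply: measurable_funM.
    exact: (measurable_comp_fst (mnphi _)).
  exact: (measurable_comp_snd (mpsih _)).
have mP2 k : measurable_fun [set: (L * L)%type] (fun p : L * L => P2 k p.1 p.2).
  apply/measurable_EFinP; apply: measurable_funM.
    exact: (measurable_comp_fst (mphih _)).
  exact: (measurable_comp_snd (mwpsi _)).
have IP1 k : (\int[mu]_x \int[mu]_u P1 k x u =
    cphi%:E * \int[mu]_u (`|psi (w * u - k%:~R)| * `|h u|)%:E)%E.
  rewrite integral2_tensor.
  - rewrite integral_norm_affine// Iphi.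
    under [X in (_ * X)%E]eq_integral do rewrite EFinM.
    rewrite ge0_integralZl_EFin.
    + by rewrite muleA -EFinM mulrAC mulVf ?gt_eqF// mul1r.
    + by [].
    + by move=> u _; rewrite lee_fin mulr_ge0.
    + by apply/measurable_EFinP; exact: measurable_funM.
    + by [].
  - exact: mnphi.
  - exact: mpsih.
  - by move=> x.
  - by move=> u; rewrite !mulr_ge0.
have IP2 k : (\int[mu]_x \int[mu]_u P2 k x u =
    cpsi%:E * \int[mu]_x (`|phi (w * x - k%:~R)| * `|h x|)%:E)%E.
  rewrite integral2_tensor.
  - rewrite muleC; congr (_ * _)%E.
    under eq_integral do rewrite EFinM.
    rewrite ge0_integralZl_EFin.
    + rewrite integral_norm_affine// Ipsi -!EFinM mulrA mulfV ?gt_eqF//.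
      by rewrite mul1r.
    + by [].
    + by move=> u _; rewrite lee_fin.
    + by apply/measurable_EFinP; exact: mnpsi.
    + by [].
  - exact: mphih.
  - exact: mwpsi.
  - by move=> x; rewrite mulr_ge0.
  - by move=> u; rewrite mulr_ge0.
have I10 k : (0 <= \int[mu]_u (`|psi (w * u - k%:~R)| * `|h u|)%:E)%E.
  by apply: integral_ge0 => u _; rewrite lee_fin mulr_ge0.
have I20 k : (0 <= \int[mu]_x (`|phi (w * x - k%:~R)| * `|h x|)%:E)%E.
  by apply: integral_ge0 => u _; rewrite lee_fin mulr_ge0.
apply: (@le_trans _ _ (\esum_(k in [set: int])
   (cphi%:E * \int[mu]_u (`|psi (w * u - k%:~R)| * `|h u|)%:E +
    cpsi%:E * \int[mu]_x (`|phi (w * x - k%:~R)| * `|h x|)%:E))%E).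
  apply: le_esum => k _; rewrite -IP1 -IP2 -ge0_integralD2.
  - apply: ge0_le_integral2.
    + exact: measurable_osc_density.
    + by apply: emeasurable_funD; [exact: mP1|exact: mP2].
    + by move=> x u; rewrite lee_fin osc_density_ge0.
    move=> x u; rewrite -EFinD lee_fin /osc_density.
    have := ler_normB (h u) (h x).
    set a := `|phi _|; set b := `|psi _| => hle.
    have ab : 0 <= a * (w * b) by rewrite !mulr_ge0// normr_ge0.
    apply: (le_trans (ler_wpM2l ab hle)).
    by rewrite le_eqVlt; apply/orP; left; apply/eqP; ring.
  - exact: mP1.
  - exact: mP2.
  - exact: P10.
  - exact: P20.
rewrite esumD; try by move=> k _; rewrite mule_ge0.
rewrite !esum_intZl// EFinD ge0_muleDl ?lee_fin ?mulr_ge0//.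
apply: leeD; rewrite EFinM -muleA; apply: lee_wpmul2l; rewrite ?lee_fin//.
- exact: periodized_integral_le.
- exact: periodized_integral_le.
Qed.

End oscillation_bound.

(* From here on osc is only unfolded through oscE. *)
Opaque osc.

(** * Oscillation of the indicator of an interval *)

Section oscillation_interval.
Context {R : realType}.
Local Notation mu := (@completed_lebesgue_measure R).
Local Notation L := (lebesgueTypeR R).

Lemma ge0_integral2_affine (w k : R) (G : R -> R -> \bar R) : 0 < w ->
  measurable_fun [set: (L * L)%type] (fun p : L * L => G p.1 p.2) ->
  (forall s t, 0 <= G s t)%E ->
  (\int[mu]_x \int[mu]_u G (w * x - k)%R (w * u - k)%R =
   (w^-1 * w^-1)%:E * \int[mu]_s \int[mu]_t G s t)%E.
Proof.
move=> w0 mG G0.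
have mI := measurable_fun_integral2 mG G0.
have I0 s : (0 <= \int[mu]_t G s t)%E by exact: integral_ge0.
transitivity (\int[mu]_x ((w^-1)%:E * \int[mu]_t G (w * x - k)%R t))%E.
  apply: eq_integral => x _; apply: ge0_integral_affine.
  - by [].
  - exact: measurable_section.
  - exact: G0.
rewrite (@ge0_integral_affine R w k
  (fun s => (w^-1)%:E * \int[mu]_t G s t)%E).
- rewrite ge0_integralZl_EFin.
  + by rewrite muleA EFinM.
  + by [].
  + by move=> s _; exact: I0.
  + exact: mI.
  + by rewrite invr_ge0 ltW.
- by [].
- by apply: emeasurable_funM; [exact: measurable_cst|exact: mI].
- by move=> s; rewrite mule_ge0// lee_fin invr_ge0 ltW.
Qed.

Lemma lebesgue_measurable_id : measurable_fun [set: L] (idfun : L -> R).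
Proof. by move=> _ A mA; rewrite setTI; exact: sub_caratheodory. Qed.

(** Bound, up to the choice of c, for 1 / w times the number of integer
    translates that an endpoint of an interval separates; t is one of the two
    points to be separated. *)
Definition itv_weight (c w t : R) : R := Num.min c (2 * (`|t| + 1) / w).

Lemma itv_weight_ge0 (c w t : R) : 0 <= c -> 0 < w -> 0 <= itv_weight c w t.
Proof.
move=> c0 w0; rewrite /itv_weight le_min c0/= divr_ge0 ?(ltW w0)//.
Qed.

Lemma measurable_itv_weight (c w : R) :
  measurable_fun [set: L] (itv_weight c w : L -> R).
Proof.
apply: measurable_minr; first exact: measurable_cst.
apply: measurable_funM; last exact: measurable_cst.
apply: measurable_funM; first exact: measurable_cst.
apply: measurable_funD; last exact: measurable_cst.
exact: (measurable_norm lebesgue_measurable_id).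
Qed.

Lemma itv_weight_cvg0 (c t : R) (v : R^nat) : 0 <= c ->
  v n @[n --> \oo] --> +oo -> itv_weight c (v n) t @[n --> \oo] --> (0 : R).
Proof.
move=> c0 voo.
have v0 : \forall n \near \oo, 0 < v n by move/cvgryPgt : voo; apply.
apply: (@squeeze_cvgr _ _ _ _ (fun=> 0) (fun n => 2 * (`|t| + 1) / v n)).
- near=> n; rewrite itv_weight_ge0 ?ge_min ?lexx ?orbT//=.
  by near: n.
- exact: cvg_cst.
- rewrite -[X in _ --> X](mulr0 (2 * (`|t| + 1))).
  apply: cvgM; first exact: cvg_cst.
  exact/gtr0_cvgV0.
Unshelve. all: by end_near. Qed.

Lemma integral_itv_weight_cvg0 (g : R -> R) (c : R) (v : R^nat) : 0 <= c ->
  (forall n, 0 < v n) -> v n @[n --> \oo] --> +oo -> lebesgue_L1 g ->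
  (\int[mu]_t (`|g t| * itv_weight c (v n) t)%:E @[n --> \oo] --> 0)%E.
Proof.
move=> c0 v0 voo ig; have [mg _] := lebesgue_L1P ig.
have [||||| _ _] := @dominated_convergence _ _ R mu setT measurableT
  (fun n t => (`|g t| * itv_weight c (v n) t)%:E) (cst 0%E)
  (fun t => (c * `|g t|)%:E).
- move=> n; apply/measurable_EFinP; apply: measurable_funM.
    exact: measurable_norm.
  exact: measurable_itv_weight.
- exact: measurable_cst.
- apply: aeW => t _; apply: cvg_EFin; first exact: nearW.
  rewrite -[X in _ --> X](mulr0 `|g t|); apply: cvgM; first exact: cvg_cst.
  exact: itv_weight_cvg0.
- under eq_fun do rewrite EFinM.
  apply: integrableZl; first by [].
  exact: (integrable_abse ig).
- apply: aeW => t n _.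
  rewrite gee0_abs ?lee_fin ?mulr_ge0 ?itv_weight_ge0//.
  by rewrite mulrC ler_wpM2r// /itv_weight ge_min lexx.
by rewrite integral0.
Qed.

Lemma minr_subadditive (c x y : R) : 0 <= c -> 0 <= x -> 0 <= y ->
  Num.min c (x + y) <= Num.min c x + Num.min c y.
Proof.
move=> c0 x0 y0.
by case: (leP c x) => ?; case: (leP c y) => ?; case: (leP c (x + y)) => ?; lra.
Qed.

(** Either count the k for which one of the two points lies in ]a, b], at most
    (b - a) w + 1 for each point, or count the k for which an endpoint
    separates the two points, at most |t - s| + 1 for each endpoint. *)
Lemma scaled_count_le (a b w s t : R) : a <= b -> 1 <= w ->
  (\esum_(k in [set: int])
     (w^-1 * `|\1_`]a, b] ((t + k%:~R) / w) - \1_`]a, b] ((s + k%:~R) / w)|)%:E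
   <= (itv_weight (2 * (b - a) + 2) w t + itv_weight (2 * (b - a) + 2) w s)%:E)%E.
Proof.
move=> ab w1; have w0 : 0 < w by lra.
have wV0 : 0 <= w^-1 by rewrite invr_ge0 ltW.
have indE r k : \1_`]a, b] ((r + k%:~R) / w) =
    (a * w - r < k%:~R <= b * w - r)%R%:R :> R.
  rewrite indicE; congr (_%:R); congr nat_of_bool.
  rewrite mem_setE in_itv/= ltr_pdivlMr// ler_pdivrMr//.
  by congr (_ && _); lra.
under eq_esum do rewrite EFinM.
rewrite esum_intZl//.
set S := esum _ _.
have abw r : a * w - r <= b * w - r by rewrite lerD2r ler_pM2r.
have S1 : (S <= (2 * ((b - a) * w + 1))%:E)%E.
  apply: (@le_trans _ _ (\esum_(k in [set: int])
     (((a * w - t < k%:~R <= b * w - t)%R%:R)%:E +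
      ((a * w - s < k%:~R <= b * w - s)%R%:R)%:E))%E).
    apply: le_esum => k _; rewrite -EFinD lee_fin !indE.
    by apply: (le_trans (ler_normB _ _)); rewrite !ger0_norm.
  rewrite esumD//; try by move=> k _; rewrite lee_fin.
  apply: (le_trans (leeD (count_int_itv_le (abw t)) (count_int_itv_le (abw s)))).
  by rewrite -EFinD lee_fin; lra.
have S2 : (S <= (2 * (`|t| + 1) + 2 * (`|s| + 1))%:E)%E.
  pose lo x := Num.min (x * w - t) (x * w - s).
  pose hi x := Num.max (x * w - t) (x * w - s).
  have lohi x : lo x <= hi x.
    by rewrite /lo /hi; case: (leP (x * w - t) (x * w - s)) => ?; lra.
  have hilo x : hi x - lo x + 1 <= (`|t| + 1) + (`|s| + 1).
    have := ler_norm t; have := ler_norm s.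
    have := ler_norm (- t); have := ler_norm (- s); rewrite !normrN.
    by rewrite /lo /hi; case: (leP (x * w - t) (x * w - s)) => ?; lra.
  apply: (@le_trans _ _ (\esum_(k in [set: int])
     (((lo a < k%:~R <= hi a)%R%:R)%:E + ((lo b < k%:~R <= hi b)%R%:R)%:E))%E).
    apply: le_esum => k _; rewrite -EFinD lee_fin !indE /lo /hi.
    have xorE (P Q : R) : (Num.min P Q < k%:~R <= Num.max P Q) =
        (P < k%:~R) (+) (Q < k%:~R).
      by rewrite gt_min le_max !(leNgt k%:~R); do 2 case: (_ < _).
    rewrite !xorE !(leNgt k%:~R).
    by do 4 case: (_ < _); rewrite /= ?subrr ?sub0r ?subr0 ?normrN ?normr0
      ?normr1 ?addr0 ?add0r ?ler01// lerDl.
  rewrite esumD//; try by move=> k _; rewrite lee_fin.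
  apply: (le_trans (leeD (count_int_itv_le (lohi a)) (count_int_itv_le (lohi b)))).
  by rewrite -EFinD lee_fin; have := hilo a; have := hilo b; lra.
apply: (@le_trans _ _ (Num.min (2 * (b - a) + 2)
    ((2 * (`|t| + 1) + 2 * (`|s| + 1)) / w))%:E).
  rewrite EFin_min le_min; apply/andP; split.
    apply: (le_trans (lee_wpmul2l _ S1)); first by rewrite lee_fin.
    rewrite -EFinM lee_fin mulrC ler_pdivrMr//; nra.
  apply: (le_trans (lee_wpmul2l _ S2)); first by rewrite lee_fin.
  by rewrite -EFinM lee_fin mulrC.
rewrite lee_fin /itv_weight (mulrDl _ _ w^-1).
apply: minr_subadditive; first lra.
- by rewrite !mulr_ge0// addr_ge0.
- by rewrite !mulr_ge0// addr_ge0.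
Qed.

End oscillation_interval.

Lemma ge0_cvge0P {R : realType} {T : Type} {F : set_system T} {FF : Filter F}
    (f : T -> \bar R) : (\forall x \near F, 0 <= f x)%E ->
  (f x @[x --> F] --> 0%E) <->
  (forall e : R, 0 < e -> \forall x \near F, (f x <= e%:E)%E).
Proof.
move=> f0; split => [/fine_cvgP[ffin /cvgr0Pnorm_le fe] e e0|fe].
  have := fe e e0 => {}fe; near=> x.
  have fx : f x \is a fin_num by near: x.
  rewrite -(fineK fx) lee_fin (le_trans (ler_norm _))//.
  by near: x.
apply/fine_cvgP; split.
  near=> x; rewrite ge0_fin_numE; last by near: x.
  by apply: (@le_lt_trans _ _ 1%:E); [near: x; exact: fe|rewrite ltry].
apply/cvgr0Pnorm_le => e e0; near=> x => /=.
have fx0 : (0 <= f x)%E by near: x.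
have fxe : (f x <= e%:E)%E by near: x; exact: fe.
rewrite ger0_norm ?fine_ge0// -lee_fin fineK//.
by rewrite ge0_fin_numE// (le_lt_trans fxe)// ltry.
Unshelve. all: by end_near. Qed.

(** The denominator c + 1 replaces c so that c = 0 is allowed. *)
Lemma mule_half_le {R : realType} (c e : R) (x : \bar R) : 0 <= c -> 0 <= e ->
  (x <= (e / 2 / (c + 1))%:E)%E -> (c%:E * x <= (e / 2)%:E)%E.
Proof.
move=> c0 e0 xe; apply: (le_trans (lee_wpmul2l _ xe)); first by rewrite lee_fin.
rewrite -EFinM lee_fin mulrA ler_pdivrMr ?ltr_wpDl// mulrC.
by rewrite ler_wpM2l ?divr_ge0// lerDl.
Qed.

Section oscillation_vanishes.
Context {R : realType}.
Local Notation mu := (@completed_lebesgue_measure R).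
Local Notation L := (lebesgueTypeR R).
Variables (phi psi : R -> R) (A B : R).
Hypotheses (phi_L1 : lebesgue_L1 phi) (psi_L1 : lebesgue_L1 psi).
Hypotheses
  (phiA : forall u : R, (\esum_(k in [set: int]) `|phi (u - k%:~R)|%:E <= A%:E)%E)
  (psiB : forall u : R, (\esum_(k in [set: int]) `|psi (u - k%:~R)|%:E <= B%:E)%E).

Let mphi : measurable_fun [set: L] phi.
Proof. by have [] := lebesgue_L1P phi_L1. Qed.

Let mpsi : measurable_fun [set: L] psi.
Proof. by have [] := lebesgue_L1P psi_L1. Qed.

Definition osc_vanishes (h : R -> R) :=
  forall e : R, 0 < e -> \forall w \near +oo, (osc phi psi w h <= e%:E)%E.

Lemma osc_vanishes_sublinear (h h1 h2 : R -> R) (c1 c2 : R) : 0 <= c1 -> 0 <= c2 ->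
  measurable_fun [set: L] h -> measurable_fun [set: L] h1 ->
  measurable_fun [set: L] h2 ->
  (forall x u, `|h u - h x| <= c1 * `|h1 u - h1 x| + c2 * `|h2 u - h2 x|) ->
  osc_vanishes h1 -> osc_vanishes h2 -> osc_vanishes h.
Proof.
move=> c10 c20 mh mh1 mh2 hle v1 v2 e e0.
have c1' : 0 < e / 2 / (c1 + 1) by rewrite !divr_gt0// ltr_wpDl.
have c2' : 0 < e / 2 / (c2 + 1) by rewrite !divr_gt0// ltr_wpDl.
have {}v1 := v1 _ c1'; have {}v2 := v2 _ c2'.
near=> w.
have w0 : 0 < w by near: w; exact: nbhs_pinfty_gt.
apply: (le_trans (osc_sublinear mphi mpsi w0 c10 c20 mh mh1 mh2 hle)).
rewrite (splitr e) EFinD.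
apply: leeD; apply: mule_half_le => //; rewrite ?(ltW e0)//; near: w.
  exact: v1.
exact: v2.
Unshelve. all: by end_near. Qed.

Lemma osc_vanishes_approx (h : R -> R) : measurable_fun [set: L] h ->
  (forall e : R, 0 < e -> exists h' : R -> R,
     [/\ measurable_fun [set: L] h', osc_vanishes h' &
         (\int[mu]_x (`|h x - h' x|)%:E <= e%:E)%E]) ->
  osc_vanishes h.
Proof.
move=> mh happ e e0.
have [C C0 Cle] := osc_le_norm phi_L1 psi_L1 phiA psiB.
have d0 : 0 < e / 2 / (C + 1) by rewrite !divr_gt0// ltr_wpDl.
have [h' [mh' vh' hh']] := happ _ d0.
have e20 : 0 < e / 2 by rewrite divr_gt0.
have {}vh' := vh' _ e20.
near=> w.
have w0 : 0 < w by near: w; exact: nbhs_pinfty_gt.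
have md : measurable_fun [set: L] (fun x => h x - h' x).
  exact: measurable_funB.
have hle x u : `|h u - h x| <=
    `|h' u - h' x| + `|(h u - h' u) - (h x - h' x)|.
  apply: le_trans (ler_normD _ _).
  by rewrite le_eqVlt; apply/orP; left; apply/eqP; congr (`|_|); ring.
apply: (le_trans (osc_subadditive mphi mpsi w0 mh mh' md hle)).
rewrite (splitr e) EFinD.
apply: leeD; first by near: w; exact: vh'.
apply: (le_trans (Cle _ _ w0 md)).
by apply: mule_half_le => //; exact: ltW.
Unshelve. all: by end_near. Qed.

(** The cut-off Num.max 1 w makes the weight nonnegative along every sequence
    tending to infinity, including its first terms. *)
Lemma integral_itv_weight_near0 (g : R -> R) (c e : R) : 0 <= c -> 0 < e ->
  lebesgue_L1 g ->
  \forall w \near +oo, (\int[mu]_t (`|g t| * itv_weight c w t)%:E <= e%:E)%E.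
Proof.
move=> c0 e0 ig.
pose J w := (\int[mu]_t (`|g t| * itv_weight c (Num.max 1 w) t)%:E)%E.
have J0 w : (0 <= J w)%E.
  apply: integral_ge0 => t _; rewrite lee_fin mulr_ge0// itv_weight_ge0//.
  by rewrite lt_max ltr01.
have Jcvg : J w @[w --> +oo] --> 0%E.
  apply/cvge_pinftyP => v voo.
  apply: (@integral_itv_weight_cvg0 R g c (fun n => Num.max 1 (v n))) => //.
    by move=> n; rewrite lt_max ltr01.
  apply: (ger_cvgy _ voo); apply: nearW => n.
  by rewrite le_max lexx orbT.
have /ge0_cvge0P Jnear := Jcvg.
have {}Jnear := Jnear (nearW _ J0) e e0.
near=> w.
have w1 : 1 <= w by near: w; exact: nbhs_pinfty_ge.
have -> : (\int[mu]_t (`|g t| * itv_weight c w t)%:E)%E = J w.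
  by rewrite /J (max_r w1).
near: w; exact: Jnear.
Unshelve. all: by end_near. Qed.

(** The substitution s = w x - k, t = w u - k makes the kernel independent of w
    and k, so that the sum over k only bears on the increments of h. *)
Lemma osc_substitution (w : R) (h : R -> R) (k : int) : 0 < w ->
  measurable_fun [set: L] h ->
  (\int[mu]_x \int[mu]_u (osc_density phi psi w h k x u)%:E =
   \int[mu]_s \int[mu]_t ((`|phi s| * `|psi t|) *
     (w^-1 * `|h ((t + k%:~R) / w) - h ((s + k%:~R) / w)|))%:E)%E.
Proof.
move=> w0 mh.
have wV0 : 0 < w^-1 by rewrite invr_gt0.
pose G (s t : R) := (`|phi s| * (w * `|psi t|) *
  `|h (w^-1 * t - - k%:~R / w) - h (w^-1 * s - - k%:~R / w)|)%:E.
have mphi1 : measurable_fun [set: (L * L)%type] (fun p : L * L => `|phi p.1|).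
  exact: (measurable_comp_fst (measurable_norm mphi)).
have mpsi2 : measurable_fun [set: (L * L)%type] (fun p : L * L => `|psi p.2|).
  exact: (measurable_comp_snd (measurable_norm mpsi)).
have mhw := measurable_comp_affine (- k%:~R / w) wV0 mh.
have mG : measurable_fun [set: (L * L)%type] (fun p : L * L => G p.1 p.2).
  apply/measurable_EFinP; apply: measurable_funM; first apply: measurable_funM.
  - exact: mphi1.
  - by apply: measurable_funM; [exact: measurable_cst|exact: mpsi2].
  - apply: (measurableT_comp (@normr_measurable R setT)).
    apply: measurable_funB.
      exact: (measurable_comp_snd mhw).
    exact: (measurable_comp_fst mhw).
have G0 s t : (0 <= G s t)%E by rewrite lee_fin !mulr_ge0// ltW.
transitivity (\int[mu]_x \int[mu]_u
    G (w * x - k%:~R)%R (w * u - k%:~R)%R)%E.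
  apply: eq_integral => x _; apply: eq_integral => u _.
  rewrite /G /osc_density; congr (_ * `|h _ - h _|)%:E; field; exact: lt0r_neq0.
rewrite ge0_integral2_affine; [|exact: w0|exact: mG|exact: G0].
rewrite -ge0_integralZl2; [|by rewrite mulr_ge0// ltW|exact: mG|exact: G0].
apply: eq_integral => s _; apply: eq_integral => t _.
rewrite /G -EFinM; congr (_%:E).
have E (r : R) : w^-1 * r - - k%:~R / w = (r + k%:~R) / w.
  by field; exact: lt0r_neq0.
rewrite !E; field; exact: lt0r_neq0.
Qed.

Lemma osc_vanishes_itv (a b : R) : a <= b -> osc_vanishes \1_`]a, b].
Proof.
move=> ab e e0.
pose c := 2 * (b - a) + 2; have c0 : 0 <= c by rewrite /c; lra.
have [_ [cphi cphi0 Iphi]] := lebesgue_L1P phi_L1.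
have [_ [cpsi cpsi0 Ipsi]] := lebesgue_L1P psi_L1.
have mh : measurable_fun [set: L] (\1_`]a, b] : L -> R).
  have mi : measurable_fun [set: R] (\1_`]a, b] : R -> R).
    exact: measurable_indic.
  exact: (measurableT_comp mi lebesgue_measurable_id).
have d1 : 0 < e / 2 / (cphi + 1) by rewrite !divr_gt0// ltr_wpDl.
have d2 : 0 < e / 2 / (cpsi + 1) by rewrite !divr_gt0// ltr_wpDl.
have npsi := integral_itv_weight_near0 c0 d1 psi_L1.
have nphi := integral_itv_weight_near0 c0 d2 phi_L1.
near=> w.
have w1 : 1 <= w by near: w; exact: nbhs_pinfty_ge.
have w0 : 0 < w by exact: lt_le_trans ltr01 w1.
have W0 t : 0 <= itv_weight c w t by exact: itv_weight_ge0.
pose Q (k : int) (s t : R) := ((`|phi s| * `|psi t|) *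
  (w^-1 * `|\1_`]a, b] ((t + k%:~R) / w) - \1_`]a, b] ((s + k%:~R) / w)|))%:E.
have Q0 k s t : (0 <= Q k s t)%E.
  by rewrite lee_fin !mulr_ge0// invr_ge0 ltW.
have mnphi := measurable_norm mphi.
have mnpsi := measurable_norm mpsi.
have wV0 : 0 < w^-1 by rewrite invr_gt0.
have mQ k : measurable_fun [set: (L * L)%type] (fun p : L * L => Q k p.1 p.2).
  apply/measurable_EFinP; apply: measurable_funM; first apply: measurable_funM.
  - exact: (measurable_comp_fst mnphi).
  - exact: (measurable_comp_snd mnpsi).
  - apply: measurable_funM; first exact: measurable_cst.
    apply: (measurableT_comp (@normr_measurable R setT)).
    have mhw : measurable_fun [set: L]
        (fun x : L => \1_`]a, b] ((x + k%:~R) / w) : R).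
      have := measurable_comp_affine (- k%:~R / w) wV0 mh.
      congr (measurable_fun _ _); apply/funext => x; congr (\1__ _).
      by field; exact: lt0r_neq0.
    apply: measurable_funB; first exact: (measurable_comp_snd mhw).
    exact: (measurable_comp_fst mhw).
pose S1 (s t : R) := (`|phi s| * (`|psi t| * itv_weight c w t))%:E.
pose S2 (s t : R) := ((`|phi s| * itv_weight c w s) * `|psi t|)%:E.
have mweight (g : R -> R) : measurable_fun [set: L] g ->
    measurable_fun [set: L] (fun x : L => `|g x| * itv_weight c w x).
  move=> mg; apply: measurable_funM; first exact: measurable_norm.
  exact: measurable_itv_weight.
have mS1 : measurable_fun [set: (L * L)%type] (fun p : L * L => S1 p.1 p.2).
  apply/measurable_EFinP; apply: measurable_funM; first exact: (measurable_comp_fst mnphi).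
  exact: (measurable_comp_snd (mweight _ mpsi)).
have mS2 : measurable_fun [set: (L * L)%type] (fun p : L * L => S2 p.1 p.2).
  apply/measurable_EFinP; apply: measurable_funM; last exact: (measurable_comp_snd mnpsi).
  exact: (measurable_comp_fst (mweight _ mphi)).
have S10 s t : (0 <= S1 s t)%E by rewrite lee_fin !mulr_ge0.
have S20 s t : (0 <= S2 s t)%E by rewrite lee_fin !mulr_ge0.
have -> : osc phi psi w \1_`]a, b] =
    (\int[mu]_s \int[mu]_t (\esum_(k in [set: int]) Q k s t))%E.
  rewrite oscE -(ge0_integral2_esum_int mQ Q0); apply: eq_esum => k _.
  exact: (osc_substitution k w0 mh).
have S12 s t : (\esum_(k in [set: int]) Q k s t <= S1 s t + S2 s t)%E.
  under eq_esum do rewrite /Q EFinM.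
  rewrite esum_intZl ?mulr_ge0//; last first.
    by move=> k; rewrite lee_fin mulr_ge0// ltW.
  apply: (le_trans (lee_wpmul2l _ (scaled_count_le s t ab w1))).
    by rewrite lee_fin mulr_ge0.
  rewrite -/c -EFinM -EFinD lee_fin le_eqVlt; apply/orP; left; apply/eqP; ring.
apply: (@le_trans _ _ (\int[mu]_s \int[mu]_t (S1 s t + S2 s t))%E).
  apply: ge0_le_integral2.
  - exact: (measurable_esum_int (fun k (p : L * L) => Q0 k p.1 p.2) mQ).
  - by apply: emeasurable_funD; [exact: mS1|exact: mS2].
  - by move=> s t; apply: esum_ge0.
  - exact: S12.
rewrite ge0_integralD2.
- rewrite integral2_tensor.
  + rewrite integral2_tensor.
    * rewrite Iphi Ipsi (splitr e) EFinD.
      apply: leeD; last rewrite muleC.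
        by apply: mule_half_le => //; [exact: ltW|near: w; exact: npsi].
      by apply: mule_half_le => //; [exact: ltW|near: w; exact: nphi].
    * exact: mweight.
    * exact: mnpsi.
    * by move=> x; rewrite mulr_ge0.
    * by [].
  + exact: mnphi.
  + exact: mweight.
  + by [].
  + by move=> x; rewrite mulr_ge0.
- exact: mS1.
- exact: mS2.
- exact: S10.
- exact: S20.
Unshelve. all: by end_near. Qed.

End oscillation_vanishes.

(** * Oscillation of integrable functions *)

Section oscillation_L1.
Context {R : realType}.
Local Notation mu := (@completed_lebesgue_measure R).
Local Notation L := (lebesgueTypeR R).

Lemma lebesgue_measurable_ocitv (X : set R) : ocitv X ->
  measurable (X : set L).
Proof. by move=> oX; exact: caratheodory_measurable_mu_ext. Qed.

(** By definition of the outer measure, E is covered by countably many intervals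
    of total length less than mu E + e / 2.  A tail of length at most e / 2 is
    then discarded: E minus the finite union lies in the tail, and the finite
    union minus E lies in the covering minus E. *)
Lemma approx_finite_union_itv (E : set L) (e : R) : 0 < e -> measurable E ->
  (mu E < +oo)%E ->
  exists (F : (set R)^nat) (N : nat), (forall k, ocitv (F k)) /\
    (\int[mu]_x (`|\1_E x - \1_(\big[setU/set0]_(k < N) F k) x|)%:E <= e%:E)%E.
Proof.
move=> e0 mE Ey.
have e20 : 0 < e / 2 by rewrite divr_gt0.
have Efin : mu E \is a fin_num by rewrite ge0_fin_numE.
have [_ [F [mF EF] <-] Fe] := lb_ereal_inf_adherent e20 Efin.
have {}Fe : (\sum_(0 <= k <oo) wlength idfun (F k) < mu E + (e / 2)%:E)%E.
  exact: Fe.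
have oF k : ocitv (F k) by exact: mF.
have mF' k : measurable (F k : set L) by exact: lebesgue_measurable_ocitv.
have muF k : mu (F k : set L) = wlength idfun (F k).
  by apply: measurable_mu_extE; exact: mF.
have Foo : (\sum_(0 <= k <oo) wlength idfun (F k) < +oo :> \bar R)%E.
  apply: (lt_trans Fe); rewrite -(fineK Efin) -EFinD; exact: ltry.
have tail := nneseries_tail_cvg Foo (fun k _ => measure_ge0 _ (F k)).
have /ge0_cvge0P :
    (\sum_(N <= k <oo) wlength idfun (F k))%E @[N --> \oo] --> (0%E : \bar R).
  exact: tail.
move=> H.
have tail0 : \forall N \near \oo, (0 <= \sum_(N <= k <oo) wlength idfun (F k) :> \bar R)%E.
  by apply: nearW => N; apply: nneseries_ge0 => k _ _; exact: measure_ge0.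
have {H} [N _ /(_ N (leqnn N)) /= Ne] := H tail0 _ e20.
exists F, N; split => //.
set V := \big[setU/set0]_(k < N) F k.
pose U := \bigcup_k F k.
pose W := \bigcup_k F (k + N)%N.
have mU : measurable (U : set L) by exact: bigcupT_measurable.
have mW : measurable (W : set L) by exact: bigcupT_measurable.
have mV : measurable (V : set L) by apply: bigsetU_measurable.
have mUE : measurable (U `\` E : set L) by exact: measurableD.
have muW : (mu W <= (e / 2)%:E)%E.
  apply: le_trans Ne; rewrite -nneseries_addn; last by move=> k; exact: measure_ge0.
  apply: (le_trans (outer_measure_sigma_subadditive (wlength idfun)^*%mu _)).
  apply: lee_nneseries => [k _ _|k _]; first exact: outer_measure_ge0.
  by rewrite -muF.
have muU : (mu U <= mu E + (e / 2)%:E)%E.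
  apply: le_trans (ltW Fe).
  apply: (le_trans (outer_measure_sigma_subadditive (wlength idfun)^*%mu _)).
  apply: lee_nneseries => [k _ _|k _]; first exact: outer_measure_ge0.
  by rewrite -muF.
have muUE : (mu (U `\` E) <= (e / 2)%:E)%E.
  rewrite measureD//; last first.
    by apply: (le_lt_trans muU); rewrite -(fineK Efin) -EFinD ltry.
  by rewrite (setIidr EF) leeBlDl.
have ind0 (X : set L) x : (0 <= (\1_X x : R)%:E)%E by rewrite lee_fin.
have mind (X : set L) : measurable X ->
    measurable_fun [set: L] (fun x : L => (\1_X x : R)%:E).
  by move=> mX; apply/measurable_EFinP; exact: measurable_indic.
have mdiff : measurable_fun [set: L]
    (fun x : L => (`|\1_E x - \1_V x| : R)%:E).
  apply/measurable_EFinP; apply: (measurableT_comp (@normr_measurable R setT)).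
  by apply: measurable_funB; exact: measurable_indic.
apply: (@le_trans _ _ (\int[mu]_x ((\1_(U `\` E) x)%:E + (\1_W x)%:E))%E).
  apply: ge0_le_integral.
  - by [].
  - by move=> x _; rewrite lee_fin.
  - exact: mdiff.
  - by apply: emeasurable_funD; exact: mind.
  move=> x _; rewrite -EFinD lee_fin !indicE.
  have [xE|xE] := boolP (x \in E); have [xV|xV] := boolP (x \in V).
  - by rewrite subrr normr0 addr_ge0.
  - rewrite subr0 normr1 [X in _ + X](_ : _ = 1) ?lerDr//.
    rewrite mem_set//; have /set_mem/EF[k _ Fkx] := xE.
    have [kN|Nk] := ltnP k N; last by exists (k - N)%N => //; rewrite subnK.
    exfalso; move/negP : xV; apply; apply/mem_set; rewrite /V -bigcup_mkord.
    by exists k.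
  - rewrite sub0r normrN normr1 [X in X + _](_ : _ = 1) ?lerDl//.
    rewrite mem_set//; split; last by move/mem_set; exact/negP.
    move/set_mem : xV; rewrite /V -bigcup_mkord => -[k _ Fkx].
    by exists k.
  - by rewrite subrr normr0 addr_ge0.
rewrite ge0_integralD.
- rewrite !integral_indic// !setIT.
  by rewrite (splitr e) EFinD; exact: leeD.
- by [].
- by move=> x _; exact: ind0.
- exact: mind.
- by move=> x _; exact: ind0.
- exact: mind.
Qed.

End oscillation_L1.

Section oscillation_L1.
Context {R : realType}.
Local Notation mu := (@completed_lebesgue_measure R).
Local Notation L := (lebesgueTypeR R).
Variables (phi psi : R -> R) (A B : R).
Hypotheses (phi_L1 : lebesgue_L1 phi) (psi_L1 : lebesgue_L1 psi).
Hypotheses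
  (phiA : forall u : R, (\esum_(k in [set: int]) `|phi (u - k%:~R)|%:E <= A%:E)%E)
  (psiB : forall u : R, (\esum_(k in [set: int]) `|psi (u - k%:~R)|%:E <= B%:E)%E).
Local Notation vanishes := (osc_vanishes phi psi).

Let mindic (X : set L) : measurable X ->
  measurable_fun [set: L] (\1_X : L -> R).
Proof. by move=> mX; exact: measurable_indic. Qed.

Lemma osc_vanishes_cst (c : R) : vanishes (cst c).
Proof.
have ab : (0 : R) <= 0 by [].
have v := osc_vanishes_itv phi_L1 psi_L1 ab.
have mi : measurable_fun [set: L] (\1_`]0, 0] : R -> R).
  by apply: mindic; apply: lebesgue_measurable_ocitv; exact: is_ocitv.
apply: (osc_vanishes_sublinear phi_L1 psi_L1 ab ab _ mi mi _ v v).
- exact: measurable_cst.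
- by move=> x u; rewrite /= subrr normr0 !mul0r addr0.
Qed.

Lemma osc_vanishesD (g h : R -> R) : measurable_fun [set: L] g ->
  measurable_fun [set: L] h -> vanishes g -> vanishes h ->
  vanishes (fun x => g x + h x).
Proof.
move=> mg mh vg vh.
apply: (osc_vanishes_sublinear phi_L1 psi_L1 ler01 ler01 _ mg mh _ vg vh).
- exact: measurable_funD.
- move=> x u; rewrite !mul1r; apply: le_trans (ler_normD _ _).
  by rewrite le_eqVlt; apply/orP; left; apply/eqP; congr (`|_|); ring.
Qed.

Lemma osc_vanishesZ (c : R) (h : R -> R) :
  measurable_fun [set: L] h -> vanishes h -> vanishes (fun x => c * h x).
Proof.
move=> mh vh.
have c0 : 0 <= `|c| by [].
have z0 : 0 <= (0 : R) by [].
apply: (osc_vanishes_sublinear phi_L1 psi_L1 c0 z0 _ mh mh _ vh vh).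
- by apply: measurable_funM; [exact: measurable_cst|exact: mh].
- by move=> x u; rewrite mul0r addr0 -normrM mulrBr.
Qed.

Lemma osc_vanishes_bigsetU (F : (set R)^nat) (N : nat) :
  (forall k, ocitv (F k)) ->
  vanishes (\1_(\big[setU/set0]_(k < N) F k)).
Proof.
move=> oF.
have mF k : measurable (F k : set L) by exact: lebesgue_measurable_ocitv.
elim: N => [|N IH]; first by rewrite big_ord0 indic0; exact: osc_vanishes_cst.
rewrite big_ord_recr /=.
set V := \big[setU/set0]_(k < N) F k in IH *.
have mV : measurable (V : set L) by apply: bigsetU_measurable.
have vF : vanishes (\1_(F N)).
  have [[a b] _ /= <-] := oF N.
  have [ab|ba] := leP a b; first exact: osc_vanishes_itv.
  have -> : `]a, b]%classic = set0.
    by apply: set_itv_ge; rewrite bnd_simp -leNgt ltW.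
  by rewrite indic0; exact: osc_vanishes_cst.
apply: (osc_vanishes_sublinear phi_L1 psi_L1 ler01 ler01 _ _ _ _ IH vF).
- by apply: mindic; exact: measurableU.
- exact: mindic.
- exact: mindic.
- move=> x u; rewrite !mul1r !indicE !in_setU.
  by do 4 case: (_ \in _); rewrite /= ?subrr ?sub0r ?subr0 ?normrN ?normr0
      ?normr1 ?addr0 ?add0r ?ler01// lerDl.
Qed.

Lemma osc_vanishes_indic (E : set L) : measurable E -> (mu E < +oo)%E ->
  vanishes (\1_E).
Proof.
move=> mE Ey; apply: (osc_vanishes_approx phi_L1 psi_L1 phiA psiB).
  exact: mindic.
move=> e e0; have [F [N [oF FE]]] := approx_finite_union_itv e0 mE Ey.
exists (\1_(\big[setU/set0]_(k < N) F k)); split.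
- apply: mindic; apply: bigsetU_measurable => k _.
  exact: lebesgue_measurable_ocitv.
- exact: osc_vanishes_bigsetU.
- exact: FE.
Qed.

Import HBSimple.

(** The preimage of a nonzero value has finite measure because the function is
    integrable; the value 0 contributes nothing. *)
Lemma osc_vanishes_sfun (g : {sfun L >-> R}) :
  mu.-integrable [set: L] (EFin \o g) -> vanishes g.
Proof.
move=> ig.
have [s gE] : exists s : seq R, (g : R -> R) =
    (fun x => \sum_(r <- s) (r * \1_(g @^-1` [set r]) x)).
  exists (finmap.enum_fset (fset_set (range g))); apply/funext => x.
  by rewrite {1}(fimfunE g) fsbig_finite.
rewrite gE.
have mE (r : R) : measurable (g @^-1` [set r] : set L).
  by rewrite -[X in measurable X]setTI; exact: measurable_funP.
have term r : vanishes (fun x => r * \1_(g @^-1` [set r]) x).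
  have [->|r0] := eqVneq r 0.
    under eq_fun do rewrite mul0r.
    exact: (osc_vanishes_cst 0).
  apply: osc_vanishesZ; first exact: mindic.
  apply: osc_vanishes_indic; first exact: mE.
  have i1 : mu.-integrable [set: L]
      (EFin \o (\1_(g @^-1` [set r]) : L -> R)).
    apply: (le_integrable measurableT _ _ (integrableZl measurableT (r^-1) ig)).
      by apply/measurable_EFinP; exact: mindic.
    move=> x _.
    rewrite -[leRHS]/(`|(r^-1 * g x)%:E|)%E !abse_EFin lee_fin indicE.
    have [/set_mem/= ->|_] := boolP (x \in _); last by rewrite normr0.
    by rewrite mulVf.
  have /integrableP[_] := i1.
  under eq_integral do rewrite /= ger0_norm//.
  by rewrite integral_indic// setIT.
elim: s {gE} => [|r s IH].
  under [X in vanishes X]eq_fun do rewrite big_nil.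
  exact: osc_vanishes_cst.
under [X in vanishes X]eq_fun do rewrite big_cons.
apply: osc_vanishesD.
- by apply: measurable_funM; [exact: measurable_cst|exact: mindic].
- apply: measurable_sum => i; apply: measurable_funM; first exact: measurable_cst.
  exact: mindic.
- exact: term.
- exact: IH.
Qed.

Theorem osc_vanishes_L1 (g : R -> R) : lebesgue_L1 g -> vanishes g.
Proof.
move=> ig; have [mg _] := lebesgue_L1P ig.
apply: (osc_vanishes_approx phi_L1 psi_L1 phiA psiB); first exact: mg.
move=> e e0.
have [s [is_ _ /ge0_cvge0P scvg]] := approximation_sfun_integrable measurableT ig.
have [|n _ /(_ n (leqnn n)) /= sn] := scvg _ _ e0.
  by apply: nearW => n; apply: integral_ge0 => x _.
exists (s n); split.
- exact: measurable_funP.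
- by apply: osc_vanishes_sfun; exact: is_.
- apply: le_trans sn; rewrite le_eqVlt; apply/orP; left; apply/eqP.
  by apply: eq_integral => x _.
Qed.

End oscillation_L1.

(** * A Jensen inequality for the operators *)

(** The integral of a nonnegative function is a supremum over the simple functions
    below it, so it is monotone without measurability.  This spares the
    measurability of S_w f. *)
Lemma ge0_le_integral_nonmeasurable d (T : measurableType d) {R : realType}
    (mu : {measure set T -> \bar R}) (f g : T -> \bar R) :
  (forall x, 0 <= f x)%E -> (forall x, f x <= g x)%E ->
  (\int[mu]_x f x <= \int[mu]_x g x)%E.
Proof.
move=> f0 fg.
rewrite !ge0_integralTE//; last by move=> x; exact: le_trans (fg x).
apply: le_ereal_sup => _ [h hf <-]; exists h => //.
by move=> x; exact: le_trans (fg x).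
Qed.

Section jensen.
Context {R : realType}.
Local Notation mu := (@completed_lebesgue_measure R).
Local Notation L := (lebesgueTypeR R).
Variables (phi psi : R -> R) (A B b : R).
Hypotheses (mphi : measurable_fun [set: L] phi)
  (mpsi : measurable_fun [set: L] psi).
Hypotheses
  (phiA : forall u : R, (\esum_(k in [set: int]) `|phi (u - k%:~R)|%:E <= A%:E)%E)
  (psi_norm : (\int[mu]_u (`|psi u|)%:E = b%:E)%E) (b_ge0 : 0 <= b).

(** The integral of F against the kernel of the operator at x, with absolute
    values; its total mass is at most A b. *)
Definition kernel_mean (w x : R) (F : R -> R) : \bar R :=
  (\esum_(k in [set: int]) \int[mu]_u
    (`|phi (w * x - k%:~R)| * (w * `|psi (w * u - k%:~R)|) * F u)%:E)%E.

Let weight_ge0 (w x u : R) (k : int) : 0 < w ->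
  0 <= `|phi (w * x - k%:~R)| * (w * `|psi (w * u - k%:~R)|).
Proof. by move=> w0; rewrite !mulr_ge0// ltW. Qed.

Let measurable_weight (w x : R) (k : int) (F : R -> R) : 0 < w ->
  measurable_fun [set: L] F ->
  measurable_fun [set: L] (fun u : L =>
    (`|phi (w * x - k%:~R)| * (w * `|psi (w * u - k%:~R)|) * F u)%:E).
Proof.
move=> w0 mF; apply/measurable_EFinP; apply: measurable_funM; last exact: mF.
apply: measurable_funM; first exact: measurable_cst.
apply: measurable_funM; first exact: measurable_cst.
exact: (measurable_norm_affine k%:~R w0 mpsi).
Qed.

Lemma le_kernel_mean (w x : R) (F G : R -> R) : 0 < w ->
  measurable_fun [set: L] F -> measurable_fun [set: L] G ->
  (forall u, 0 <= F u) -> (forall u, F u <= G u) ->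
  (kernel_mean w x F <= kernel_mean w x G)%E.
Proof.
move=> w0 mF mG F0 FG; apply: le_esum => k _; apply: ge0_le_integral.
- by [].
- by move=> u _; rewrite lee_fin mulr_ge0// weight_ge0.
- exact: measurable_weight.
- exact: measurable_weight.
- by move=> u _; rewrite lee_fin ler_wpM2l// weight_ge0.
Qed.

Lemma kernel_meanZ (w x c : R) (F : R -> R) : 0 < w -> 0 <= c ->
  measurable_fun [set: L] F -> (forall u, 0 <= F u) ->
  kernel_mean w x (fun u => c * F u) = (c%:E * kernel_mean w x F)%E.
Proof.
move=> w0 c0 mF F0; rewrite -esum_intZl//; last first.
  by move=> k; apply: integral_ge0 => u _; rewrite lee_fin mulr_ge0// weight_ge0.
apply: eq_esum => k _; rewrite -ge0_integralZl_EFin.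
- by apply: eq_integral => u _; rewrite -EFinM mulrCA.
- by [].
- by move=> u _; rewrite lee_fin mulr_ge0// weight_ge0.
- exact: measurable_weight.
- by [].
Qed.

Lemma kernel_mean_addr_le (w x c : R) (F : R -> R) : 0 < w -> 0 <= c ->
  measurable_fun [set: L] F -> (forall u, 0 <= F u) ->
  (kernel_mean w x (fun u => (F u + c)%R) <= kernel_mean w x F + (c * (A * b))%:E)%E.
Proof.
move=> w0 c0 mF F0.
have w0' := ltW w0.
have I0 k : (0 <= \int[mu]_u (`|phi (w * x - k%:~R)| *
    (w * `|psi (w * u - k%:~R)|) * F u)%:E)%E.
  by apply: integral_ge0 => u _; rewrite lee_fin mulr_ge0// weight_ge0.
have -> : kernel_mean w x (fun u => F u + c) =
    (\esum_(k in [set: int]) (\int[mu]_u (`|phi (w * x - k%:~R)| *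
      (w * `|psi (w * u - k%:~R)|) * F u)%:E +
      (c * b)%:E * `|phi (w * x - k%:~R)|%:E))%E.
  apply: eq_esum => k _.
  have -> : ((c * b)%:E * `|phi (w * x - k%:~R)|%:E =
      \int[mu]_u (`|phi (w * x - k%:~R)| *
        (w * `|psi (w * u - k%:~R)|) * c)%:E)%E.
    transitivity (\int[mu]_u ((c * `|phi (w * x - k%:~R)| * w)%:E *
        (`|psi (w * u - k%:~R)|)%:E))%E; last first.
      by apply: eq_integral => u _; rewrite -EFinM; congr (_%:E); ring.
    rewrite ge0_integralZl_EFin.
    - rewrite integral_norm_affine// psi_norm -!EFinM; congr (_%:E).
      by field; exact: lt0r_neq0.
    - by [].
    - by move=> u _; rewrite lee_fin.
    - apply/measurable_EFinP.
      exact: (measurable_norm_affine k%:~R w0 mpsi).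
    - by rewrite !mulr_ge0.
  rewrite -ge0_integralD.
  - by apply: eq_integral => u _; rewrite -EFinD mulrDr.
  - by [].
  - by move=> u _; rewrite lee_fin mulr_ge0// weight_ge0.
  - exact: measurable_weight.
  - by move=> u _; rewrite lee_fin mulr_ge0// weight_ge0.
  - by apply: (measurable_weight _ _ w0); exact: measurable_cst.
rewrite esumD; [|by move=> k _; exact: I0|]; last first.
  by move=> k _; rewrite -EFinM lee_fin !mulr_ge0.
apply: leeD; first by [].
rewrite esum_intZl//; last by rewrite mulr_ge0.
apply: (le_trans (lee_wpmul2l _ (phiA (w * x)))).
  by rewrite lee_fin mulr_ge0.
by rewrite -EFinM lee_fin le_eqVlt; apply/orP; left; apply/eqP; ring.
Qed.

(** The supporting line m v <= eta v + c at T, integrated against the kernel,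
    gives m A b T <= E + c A b with E the integral of eta (lambda A b |f u - f x|),
    that is A b eta T <= E, since c = m T - eta T; and eta_dist_le bounds E. *)
Lemma jensen_eta (alpha w x T lambda : R) (f : R -> R) : 1 <= alpha -> 0 < w ->
  0 < A -> 0 < b -> 0 <= lambda -> measurable_fun [set: L] f -> 0 <= T ->
  measurable_fun [set: L] (fun u => signed_eta alpha (lambda * (A * b) * f u)) ->
  (T%:E <= lambda%:E * kernel_mean w x (fun u => `|f u - f x|%R))%E ->
  ((A * b)%:E * (eta alpha T)%:E <= kernel_mean w x
    (fun u => `|signed_eta alpha (lambda * (A * b) * f u) -
                signed_eta alpha (lambda * (A * b) * f x)|%R))%E.
Proof.
move=> alpha1 w0 A0 b0 l0 mf T0 mG Tle.
have [m [c [m0 c0 cE line]]] := eta_supporting_line alpha1 T0.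
set D := fun u => `|_|.
have Ab0 : 0 < A * b by rewrite mulr_gt0.
have mD : measurable_fun [set: L] D.
  apply: (measurableT_comp (@normr_measurable R setT)).
  by apply: measurable_funB; [exact: mG|exact: measurable_cst].
have mfx : measurable_fun [set: L] (fun u : L => `|f u - f x|).
  apply: (measurableT_comp (@normr_measurable R setT)).
  by apply: measurable_funB; [exact: mf|exact: measurable_cst].
have key : ((m * (A * b) * T)%:E <= kernel_mean w x D + (c * (A * b))%:E)%E.
  apply: le_trans (kernel_mean_addr_le _ w0 c0 mD _); last by move=> u; exact: normr_ge0.
  apply: (@le_trans _ _ (kernel_mean w x
      (fun u => m * (lambda * (A * b)) * `|f u - f x|))).
    rewrite kernel_meanZ//; last by rewrite !mulr_ge0// ltW.
    have -> : m * (lambda * (A * b)) = m * (A * b) * lambda by ring.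
    rewrite (EFinM (m * (A * b)) T) (EFinM (m * (A * b)) lambda) -muleA.
    by apply: lee_wpmul2l Tle; rewrite lee_fin mulr_ge0// ltW.
  apply: le_kernel_mean.
  - by [].
  - by apply: measurable_funM; [exact: measurable_cst|exact: mfx].
  - by apply: measurable_funD; [exact: mD|exact: measurable_cst].
  - by move=> u; rewrite !mulr_ge0// ltW.
  - move=> u; have v0 : 0 <= lambda * (A * b) * `|f u - f x|.
      by rewrite !mulr_ge0// ltW.
    rewrite -mulrA; apply: (le_trans (line _ v0)); rewrite lerD2r.
    have := eta_dist_le alpha1 (lambda * (A * b) * f u) (lambda * (A * b) * f x).
    by rewrite -mulrBr normrM (ger0_norm (_ : 0 <= lambda * (A * b)))// mulr_ge0// ltW.
move: key; case: (kernel_mean w x D) => [r| |].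
- rewrite -EFinD -EFinM !lee_fin cE => key.
  by rewrite -(lerD2r (A * b * (m * T - eta alpha T))); lra.
- by move=> _; rewrite leey.
- by [].
Qed.

End jensen.

(** * Convergence of the operators *)

Section durrmeyer.
Context {R : realType}.
Local Notation mu := (@completed_lebesgue_measure R).
Local Notation L := (lebesgueTypeR R).

Lemma measurable_eta (alpha : R) : measurable_fun [set: R] (@eta R alpha).
Proof.
apply: measurable_funB; last exact: measurable_cst.
exact: (measurableT_comp (@measurable_expR R) (@measurable_powR R alpha)).
Qed.

Lemma measurable_signed_eta (alpha : R) :
  measurable_fun [set: R] (@signed_eta R alpha).
Proof.
apply: measurable_funB.
  apply: (measurableT_comp (measurable_eta alpha)).
  apply: measurable_funM; first exact: measurable_cst.
  by apply: measurable_maxr; [exact: measurable_id|exact: measurable_cst].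
apply: (measurableT_comp (measurable_eta alpha)).
apply: measurable_funM; first exact: measurable_cst.
by apply: measurable_maxr; [exact: oppr_measurable|exact: measurable_cst].
Qed.

Variables (phi psi : R -> R) (A B : R).
Hypotheses (phi_L1 : lebesgue_L1 phi) (psi_L1 : lebesgue_L1 psi).
Hypotheses
  (phiA : forall u : R, (\esum_(k in [set: int]) `|phi (u - k%:~R)|%:E <= A%:E)%E)
  (psiB : forall u : R, (\esum_(k in [set: int]) `|psi (u - k%:~R)|%:E <= B%:E)%E).

Let mphi : measurable_fun [set: L] phi.
Proof. by have [] := lebesgue_L1P phi_L1. Qed.

Let mpsi : measurable_fun [set: L] psi.
Proof. by have [] := lebesgue_L1P psi_L1. Qed.

(** It makes psi (w u - k) f u integrable: the constant 1 is paired with psi in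
    L1, and eta, which is integrable on f, with psi bounded. *)
Lemma normr_le1_eta (alpha t : R) : 1 <= alpha -> 0 <= t ->
  t <= 1 + eta alpha t.
Proof.
move=> alpha1 t0; have [t1|t1] := leP t 1.
  by rewrite (le_trans t1)// lerDl eta_ge0.
apply: (@le_trans _ _ (t `^ alpha)); first by apply: le1r_powR => //; exact: ltW.
by apply: (le_trans (powR_le_eta _ _)); rewrite lerDr.
Qed.

Lemma kernel_coefficient_bound (alpha lambda w : R) (f : R -> R) :
  1 <= alpha -> 0 < lambda -> 0 < w -> measurable_fun [set: L] f ->
  (\int[mu]_x (eta alpha (lambda * `|f x|))%:E < +oo)%E ->
  exists N : R, forall k : int,
    lebesgue_L1 (fun u => psi (w * u - k%:~R) * f u) /\
    (\int[mu]_u (`|psi (w * u - k%:~R)| * `|f u|)%:E <= N%:E)%E.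
Proof.
move=> alpha1 l0 w0 mf fy.
have [_ [cpsi cpsi0 Ipsi]] := lebesgue_L1P psi_L1.
have B0 : 0 <= B by apply: le_trans (periodization_pointwise psiB 0).
have mef : measurable_fun [set: L] (fun x : L => eta alpha (lambda * `|f x|)).
  apply: (measurableT_comp (measurable_eta alpha)).
  by apply: measurable_funM; [exact: measurable_cst|exact: measurable_norm].
have [E EE] : exists E : R, (\int[mu]_x (eta alpha (lambda * `|f x|))%:E = E%:E)%E.
  exists (fine (\int[mu]_x (eta alpha (lambda * `|f x|))%:E)%E).
  rewrite fineK// ge0_fin_numE//; apply: integral_ge0 => x _.
  by rewrite lee_fin eta_ge0.
exists (lambda^-1 * (w^-1 * cpsi + B * E)) => k.
have mpk := measurable_norm_affine k%:~R w0 mpsi.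
have lV0 : 0 <= lambda^-1 by rewrite invr_ge0 ltW.
have mpf : measurable_fun [set: L]
    (fun u : L => (`|psi (w * u - k%:~R)| * `|f u|)%:E).
  apply/measurable_EFinP; apply: measurable_funM; first exact: mpk.
  exact: measurable_norm.
have le : (\int[mu]_u (`|psi (w * u - k%:~R)| * `|f u|)%:E <=
    (lambda^-1 * (w^-1 * cpsi + B * E))%:E)%E.
  apply: (@le_trans _ _ (\int[mu]_u (lambda^-1%:E *
      ((`|psi (w * u - k%:~R)|)%:E + B%:E * (eta alpha (lambda * `|f u|))%:E)))%E).
    apply: ge0_le_integral.
    - by [].
    - by move=> u _; rewrite lee_fin mulr_ge0.
    - exact: mpf.
    - apply: emeasurable_funM; first exact: measurable_cst.
      apply: emeasurable_funD; first by apply/measurable_EFinP; exact: mpk.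
      apply: emeasurable_funM; first exact: measurable_cst.
      by apply/measurable_EFinP; exact: mef.
    - move=> u _; rewrite -(EFinM B) -EFinD -EFinM lee_fin ler_pdivlMl//.
      rewrite mulrCA.
      have t0 : 0 <= lambda * `|f u| by rewrite mulr_ge0// ltW.
      apply: (le_trans (ler_wpM2l _ (normr_le1_eta alpha1 t0))) => //.
      rewrite mulrDr mulr1 lerD2l ler_wpM2r ?eta_ge0//.
      exact: periodization_pointwise.
  rewrite ge0_integralZl_EFin.
  - rewrite ge0_integralD.
    + rewrite integral_norm_affine// Ipsi ge0_integralZl_EFin.
      * by rewrite EE -(EFinM w^-1) -(EFinM B) -EFinD -EFinM.
      * by [].
      * by move=> u _; rewrite lee_fin eta_ge0.
      * by apply/measurable_EFinP; exact: mef.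
      * by [].
    + by [].
    + by move=> u _; rewrite lee_fin.
    + by apply/measurable_EFinP; exact: mpk.
    + by move=> u _; rewrite -EFinM lee_fin mulr_ge0// eta_ge0.
    + apply: emeasurable_funM; first exact: measurable_cst.
      by apply/measurable_EFinP; exact: mef.
  - by [].
  - by move=> u _; rewrite adde_ge0// -EFinM lee_fin mulr_ge0// eta_ge0.
  - apply: emeasurable_funD; first by apply/measurable_EFinP; exact: mpk.
    apply: emeasurable_funM; first exact: measurable_cst.
    by apply/measurable_EFinP; exact: mef.
  - by [].
split; last exact: le.
apply/integrableP; split.
  apply/measurable_EFinP; apply: measurable_funM; last exact: mf.
  exact: measurable_comp_affine.
apply: le_lt_trans (ltry (lambda^-1 * (w^-1 * cpsi + B * E))).
apply: le_trans le; rewrite le_eqVlt; apply/orP; left; apply/eqP.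
by apply: eq_integral => u _; rewrite /= normrM.
Qed.

Lemma durrmeyer_defined_of_bound (w N : R) (f : R -> R) : 0 < w ->
  (forall k : int,
    lebesgue_L1 (fun u => psi (w * u - k%:~R) * f u) /\
    (\int[mu]_u (`|psi (w * u - k%:~R)| * `|f u|)%:E <= N%:E)%E) ->
  durrmeyer_defined phi psi w f.
Proof.
move=> w0 fN; split; first by move=> k; have [] := fN k.
move=> x.
have N0 : 0 <= N.
  rewrite -lee_fin; apply: le_trans (proj2 (fN 0)).
  by apply: integral_ge0 => u _; rewrite lee_fin mulr_ge0.
have coef k : `|\int[mu]_u (psi (w * u - k%:~R) * f u)| <= N.
  have [i iN] := fN k; rewrite -lee_fin; apply: le_trans iN.
  rewrite EFin_normr_Rintegral; [|exact: measurableT|exact: i].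
  apply: (le_trans (le_abse_integral mu measurableT (measurable_int mu i))).
  rewrite le_eqVlt; apply/orP; left; apply/eqP.
  by apply: eq_integral => u _; rewrite /= normrM.
apply: (proj1 (zseries_summable _)).
apply: (@le_lt_trans _ _ (w * N * A)%:E); last exact: ltry.
apply: (@le_trans _ _ (\esum_(k in [set: int])
    ((w * N)%:E * `|phi (w * x - k%:~R)|%:E))%E).
  apply: le_esum => k _; rewrite -EFinM lee_fin /durrmeyer_term !normrM.
  rewrite mulrC (ger0_norm (ltW w0)); apply: ler_wpM2r; first by [].
  by apply: ler_wpM2l; [exact: ltW|exact: coef].
have wN0 : 0 <= w * N by rewrite mulr_ge0// ltW.
rewrite esum_intZl// (EFinM (w * N) A); apply: lee_wpmul2l; first by rewrite lee_fin.
exact: phiA.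
Qed.

End durrmeyer.

Section durrmeyer_error.
Context {R : realType}.
Local Notation mu := (@completed_lebesgue_measure R).
Local Notation L := (lebesgueTypeR R).
Variables (phi psi : R -> R).
Hypotheses (kernels : kernel_pair phi psi).

Let phi_L1 := kernel_phi_L1 kernels.
Let psi_L1 := kernel_psi_L1 kernels.

(** Both normalizations enter here: f x is the sum over k of phi (w x - k) f x,
    and f x is w times the integral of psi (w u - k) f x. *)
Lemma durrmeyer_error_le (w x : R) (f : R -> R) : 0 < w ->
  measurable_fun [set: L] f ->
  durrmeyer_defined phi psi w f ->
  (`|durrmeyer phi psi w f x - f x|%:E <=
    kernel_mean phi psi w x (fun u => `|f u - f x|%R))%E.
Proof.
move=> w0 mf [iff zf].
have [phi_cvg phi1] := kernel_phi_sum kernels (w * x).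
have [mpsi _] := lebesgue_L1P psi_L1.
have [cphi2 phi2] := zsumMr (f x) phi_cvg.
have iw k := lebesgue_L1_affine k%:~R w0 psi_L1.
have idiff (k : int) : lebesgue_L1 (fun u => psi (w * u - k%:~R) * (f u - f x)).
  have -> : (fun u => psi (w * u - k%:~R) * (f u - f x)) =
      (fun u => psi (w * u - k%:~R) * f u - f x * psi (w * u - k%:~R)).
    by apply/funext => u; ring.
  exact: (integrableB measurableT (iff k) (integrableZl measurableT (f x) (iw k))).
have E (k : int) : durrmeyer_term phi psi w f x k - phi (w * x - k%:~R) * f x =
    phi (w * x - k%:~R) *
      (w * \int[mu]_u (psi (w * u - k%:~R) * (f u - f x))).
  have -> : \int[mu]_u (psi (w * u - k%:~R) * (f u - f x)) =
      \int[mu]_u (psi (w * u - k%:~R) * f u) - f x * w^-1.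
    have <- : \int[mu]_u (f x * psi (w * u - k%:~R)) = f x * w^-1.
      rewrite (RintegralZl (f x) measurableT (iw k)).
      by rewrite (Rintegral_affine k%:~R w0 psi_L1) (kernel_psi_int kernels) mulr1.
    rewrite -(RintegralB measurableT (iff k)).
      by apply: eq_Rintegral => u _; ring.
    exact: (integrableZl measurableT (f x) (iw k)).
  by rewrite /durrmeyer_term; field; exact: lt0r_neq0.
have -> : durrmeyer phi psi w f x - f x = zsum (fun k =>
    phi (w * x - k%:~R) *
      (w * \int[mu]_u (psi (w * u - k%:~R) * (f u - f x)))).
  transitivity (zsum (fun k =>
      durrmeyer_term phi psi w f x k - phi (w * x - k%:~R) * f x)).
    by rewrite (zsumB (zf x) cphi2) phi2 phi1 mul1r.
  by congr zsum; apply/funext => k; exact: E.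
have le : (\esum_(k in [set: int]) `|phi (w * x - k%:~R) *
      (w * \int[mu]_u (psi (w * u - k%:~R) * (f u - f x)))|%:E <=
    kernel_mean phi psi w x (fun u => `|f u - f x|%R))%E.
  apply: le_esum => k _.
  have mabs : measurable_fun [set: L]
      (fun u : L => (`|psi (w * u - k%:~R)| * `|f u - f x|)%:E).
    apply/measurable_EFinP; apply: measurable_funM.
      exact: (measurable_norm_affine k%:~R w0 mpsi).
    apply: (measurableT_comp (@normr_measurable R setT)).
    by apply: measurable_funB; [exact: mf|exact: measurable_cst].
  have -> : (\int[mu]_u (`|phi (w * x - k%:~R)| * (w * `|psi (w * u - k%:~R)|) *
      `|f u - f x|)%:E = (`|phi (w * x - k%:~R)| * w)%:E *
      \int[mu]_u (`|psi (w * u - k%:~R)| * `|f u - f x|)%:E)%E.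
    rewrite -ge0_integralZl_EFin.
    - by apply: eq_integral => u _; rewrite -EFinM; congr (_%:E); ring.
    - by [].
    - by move=> u _; rewrite lee_fin mulr_ge0.
    - exact: mabs.
    - by rewrite mulr_ge0// ltW.
  rewrite !normrM mulrA (ger0_norm (ltW w0)) EFinM.
  apply: lee_wpmul2l; first by rewrite lee_fin mulr_ge0// ltW.
  rewrite EFin_normr_Rintegral; [|exact: measurableT|exact: idiff].
  apply: (le_trans (le_abse_integral mu measurableT
    (measurable_int mu (idiff k)))).
  rewrite le_eqVlt; apply/orP; left; apply/eqP.
  by apply: eq_integral => u _; rewrite /= normrM.
have [ley|] := ltP (kernel_mean phi psi w x (fun u => `|f u - f x|%R)) +oo%E.
  by apply: (le_trans (proj2 (zseries_summable (le_lt_trans le ley)))).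
by rewrite leye_eq => /eqP ->; rewrite leey.
Qed.

End durrmeyer_error.

Unset Implicit Arguments.

Theorem corollary6p6 (R : realType) (alpha : R) (phi psi f : R -> R)
  (alpha_ge1 : 1 <= alpha)
  (kernels : kernel_pair phi psi)
  (psi_moment0 : (abs_moment 0 psi < +oo)%E)
  (f_exp : exp_space alpha f) :
  (forall w : R, 0 < w -> durrmeyer_defined phi psi w f) /\
  exists2 lambda : R, 0 < lambda &
    (\int[@completed_lebesgue_measure R]_x
       (expR ((lambda * `|durrmeyer phi psi w f x - f x|) `^ alpha) - 1)%:E)%E
      @[w --> +oo%R] --> 0%E.
Proof.
have phi_L1 := kernel_phi_L1 kernels.
have psi_L1 := kernel_psi_L1 kernels.
have [r r0 rphi] := kernel_phi_moment kernels.
have [A phiA] := abs_moment_bound r0 (kernel_phi_bounded kernels) rphi.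
have [B psiB] := abs_moment0_bound psi_moment0.
have [mphi _] := lebesgue_L1P phi_L1.
have [mpsi [b b0 psib]] := lebesgue_L1P psi_L1.
have [mf [l l0 fl]] := f_exp.
have fdef w : 0 < w -> durrmeyer_defined phi psi w f.
  move=> w0.
  have [N fN] := kernel_coefficient_bound psi_L1 psiB alpha_ge1 l0 w0 mf fl.
  exact: (durrmeyer_defined_of_bound phiA w0 fN).
split; first exact: fdef.
have A1 : 1 <= A.
  have [_ phi1] := kernel_phi_sum kernels 0.
  rewrite -lee_fin; apply: le_trans (phiA 0).
  have := proj2 (zseries_summable (le_lt_trans (phiA 0) (ltry A))).
  by rewrite phi1 normr1.
have b1 : 1 <= b.
  rewrite -lee_fin -psib -[X in (X <= _)%E](_ : `|1|%:E = 1%:E); last by rewrite normr1.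
  rewrite -(kernel_psi_int kernels) EFin_normr_Rintegral; [|exact: measurableT|exact: psi_L1].
  exact: (le_abse_integral _ measurableT (measurable_int _ psi_L1)).
have A0 : 0 < A by exact: lt_le_trans ltr01 A1.
have {}b0 : 0 < b by exact: lt_le_trans ltr01 b1.
have Ab0 : 0 < A * b by rewrite mulr_gt0.
have [lambda lambda0 lambdaE] : exists2 lambda : R,
    0 < lambda & lambda * (A * b) * 2 = l.
  exists (l / (A * b * 2)); first by rewrite divr_gt0// mulr_gt0.
  by rewrite -mulrA divfK// gt_eqF// mulr_gt0.
exists lambda; first exact: lambda0.
pose G (u : R) := signed_eta alpha (lambda * (A * b) * f u).
have mG : measurable_fun [set: lebesgueTypeR R] G.
  apply: (measurableT_comp (measurable_signed_eta alpha)).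
  by apply: measurable_funM; [exact: measurable_cst|exact: mf].
have G_norm u : `|G u| = eta alpha (l * `|f u|).
  rewrite /G (norm_signed_eta alpha_ge1) -lambdaE; congr (eta alpha _).
  rewrite normrM ger0_norm; first by ring.
  exact: ltW (mulr_gt0 lambda0 Ab0).
have G_L1 : lebesgue_L1 G.
  apply/integrableP; split; first exact/measurable_EFinP.
  apply: le_lt_trans fl; rewrite le_eqVlt; apply/orP; left; apply/eqP.
  apply: eq_integral => u _; rewrite -[LHS]/((`|G u|)%:E) G_norm.
  by [].
apply/ge0_cvge0P.
  by apply: nearW => w; apply: integral_ge0 => x _; rewrite lee_fin eta_ge0.
move=> e e0.
have Abe : 0 < A * b * e by exact: mulr_gt0.
have Gnear := osc_vanishes_L1 phi_L1 psi_L1 phiA psiB G_L1 Abe.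
near=> w.
have w0 : 0 < w by near: w; exact: nbhs_pinfty_gt.
have oscw : (osc phi psi w G <= (A * b * e)%:E)%E by near: w; exact: Gnear.
pose K (x : R) := kernel_mean phi psi w x (fun u => `|G u - G x|%R).
have pointwise x : ((eta alpha (lambda * `|durrmeyer phi psi w f x - f x|))%:E
    <= ((A * b)^-1)%:E * K x)%E.
  rewrite lee_pdivlMl//.
  apply: (jensen_eta mpsi phiA psib (ltW b0) alpha_ge1 w0 A0 b0 (ltW lambda0) mf
    _ mG).
    by rewrite mulr_ge0// ltW.
  rewrite EFinM; apply: lee_wpmul2l; first by rewrite lee_fin ltW.
  exact: (durrmeyer_error_le kernels x w0 mf (fdef w w0)).
have D0 k x u : (0 <= (osc_density phi psi w G k x u)%:E)%E.
  by rewrite lee_fin osc_density_ge0.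
have mD k := measurable_fun_integral2 (measurable_osc_density mphi mpsi k w0 mG)
  (D0 k).
have I0 k (x : lebesgueTypeR R) :
    (0 <= \int[@completed_lebesgue_measure R]_u
       (osc_density phi psi w G k x u)%:E)%E.
  by apply: integral_ge0 => u _; exact: D0.
apply: (@le_trans _ _ (\int[@completed_lebesgue_measure R]_x (((A * b)^-1)%:E * K x))%E).
  apply: ge0_le_integral_nonmeasurable => x.
    by rewrite lee_fin eta_ge0.
  exact: pointwise.
rewrite ge0_integralZl_EFin.
- rewrite lee_pdivrMl// -EFinM; apply: le_trans oscw.
  by rewrite oscE -(ge0_integral_esum_int (@completed_lebesgue_measure R) I0 mD).
- by [].
- by move=> x _; apply: esum_ge0 => k _; exact: I0.
- exact: (measurable_esum_int I0 mD).
- by rewrite invr_ge0 ltW.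
Unshelve. all: by end_near. Qed.
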